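(* Let $\varphi:\mathbb{D}\to\mathbb{C}$ be an analytic univalent function with positive real part in $\mathbb{D}$, with $\varphi(0)=1$, $\varphi'(0)>0$ and $\varphi''(0)\in\mathbb{R}$, and write $\varphi(z)=1+B_1z+B_2z^2+\cdots$. Suppose that $0<B_1\le |B_2+B_1^2|$. Then every $f\in\mathcal{K}(\varphi)$ satisfies $$|T_2(2)|\le \frac1{36}\,(B_1^2+B_2)^2+\frac14B_1^2,$$ where $T_2(2)$ is the Toeplitz determinant of $f$. The bound is sharp, i.e. for each such $\varphi$ there is a function $f\in\mathcal{K}(\varphi)$ for which equality holds.
   Context: $\mathbb{D}$ is the open unit disk in $\mathbb{C}$. $\mathcal{A}$ is the class of analytic functions $f:\mathbb{D}\to\mathbb{C}$ with Taylor series $f(z)=z+\sum_{n\ge2}a_nz^n$, and $\mathcal{S}\subset\mathcal{A}$ is the subclass of univalent (one-to-one) functions. For analytic functions $g,F$ on $\mathbb{D}$, $g$ is subordinate to $F$, written $g\prec F$, if there is an analytic $w:\mathbb{D}\to\mathbb{D}$ with $w(0)=0$ such that $g(z)=F(w(z))$ for all $z\in\mathbb{D}$. The class $\mathcal{K}(\varphi)$ is $$\mathcal{K}(\varphi):=\left\{f\in\mathcal{S}:\ 1+\frac{zf''(z)}{f'(z)}\prec\varphi(z)\right\}.$$ For $f(z)=z+\sum_{n\ge2}a_nz^n$, $T_q(n)$ denotes the determinant of the $q\times q$ symmetric Toeplitz matrix whose $(i,j)$ entry is $a_{n+|i-j|}$; in particular $T_2(2)=\begin{vmatrix} a_2 &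 a_3 \\ a_3 & a_2 \end{vmatrix}$, so $|T_2(2)|=|a_3^2-a_2^2|$. *)

(* Defs.v *)
From Stdlib Require Import Factorial Reals.
From Coquelicot Require Import Coquelicot.
Open Scope R_scope.

(** Functions on the unit disk are total functions [C -> C]; only their values
    on [unit_disk] matter, since the disk is open and derivatives are local. *)
Definition unit_disk (z : C) : Prop := Cmod z < 1.

(** [C_derive] is a total operator; at points where the complex derivative
    exists it is that derivative ([C_derive_correct]). *)
Definition analytic_on_disk (f : C -> C) : Prop :=
  forall z : C, unit_disk z -> @ex_derive C_AbsRing C_NormedModule f z.

Definition univalent_on_disk (f : C -> C) : Prop :=
  forall z1 z2 : C, unit_disk z1 -> unit_disk z2 -> f z1 = f z2 -> z1 = z2.

Definition C_derive_n (f : C -> C) (n : nat) : C -> C := Nat.iter n C_derive f.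

Definition taylor_coeff (f : C -> C) (n : nat) : C :=
  (C_derive_n f n 0 / RtoC (INR (fact n)))%C.

Definition class_A (f : C -> C) : Prop :=
  analytic_on_disk f /\ taylor_coeff f 0 = RtoC 0 /\ taylor_coeff f 1 = RtoC 1.

Definition class_S (f : C -> C) : Prop := class_A f /\ univalent_on_disk f.

Definition subordinate (g F : C -> C) : Prop :=
  exists w : C -> C,
    analytic_on_disk w /\
    (forall z : C, unit_disk z -> unit_disk (w z)) /\
    w (RtoC 0) = RtoC 0 /\
    (forall z : C, unit_disk z -> g z = F (w z)).

(** The derivative of a univalent function has no zero, so the quotient below
    never divides by zero on the disk. *)
Definition class_K (phi f : C -> C) : Prop :=
  class_S f /\
  subordinate (fun z : C => (1 + z * C_derive (C_derive f) z / C_derive f z)%C) phi.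

(** Determinant of [M i j], [0 <= i, j < q], by Laplace expansion along row 0. *)
Fixpoint Cdet (q : nat) (M : nat -> nat -> C) : C :=
  match q with
  | O => RtoC 1
  | S p =>
      sum_n (fun j : nat =>
               (RtoC ((-1) ^ j) * M O j *
                Cdet p (fun i k : nat => M (S i) (if Nat.ltb k j then k else S k)))%C)
            p
  end.

(** [T_q(n)]; with truncated subtraction, [(i - j) + (j - i)] is [|i - j|]. *)
Definition toeplitz_det (f : C -> C) (q n : nat) : C :=
  Cdet q (fun i j : nat => taylor_coeff f (n + ((i - j) + (j - i)))).

(* Main.v *)
Require Import Defs.
From Stdlib Require Import Reals.
From Coquelicot Require Import Coquelicot.
From Stdlib Require Import Factorial Lra ClassicalEpsilon.
Open Scope R_scope.

(** If [1 + z f''/f' = phi (w z)] with [w z = c1 z + c2 z^2 + ...], comparing coefficients gives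
    [2 a2 = B1 c1] and [6 a3 = B1 c2 + (B2 + B1^2) c1^2].  Since [|c1| <= 1] and
    [|c2| <= 1 - |c1|^2], the assumption [B1 <= |B2 + B1^2|] yields [6 |a3| <= |B2 + B1^2|] and
    [2 |a2| <= B1], and [|a3^2 - a2^2| <= |a3|^2 + |a2|^2] is the bound.  For [w z = i z] one has
    [a2^2 < 0 <= a3^2] and equality holds; the corresponding [f] has [f' = exp p] with
    [z p' = phi (i z) - 1].

    It is univalent because it is convex: for [|z1| <= |z2|], [z1 <> z2] and [n = z2 f'(z2)], the
    function [Re (conj n f)] on the disk [|z| <= |z2|] attains its maximum only at [z2].  It has no
    interior maximum since [f'] does not vanish, and on the circle its angular derivative has the
    sign of [- sin beta], where the tangent angle [beta] increases from 0 to 2 pi.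

    Complex differentiability at every point is turned into smoothness by Goursat's lemma on
    triangles, which gives a primitive, and Cauchy's formula for that continuously differentiable
    primitive. *)

(** * Complex derivatives *)

(** The bound is sharp because both estimates are extremal at |c1| = 1: |a2| is proportional to
    |c1|, and 6 |a3| is bounded by the mean of [B1] and |B2 + B1^2| with weights 1 - |c1|^2 and
    |c1|^2, which the assumption on [B1] makes largest at the same place. The triangle inequality
    for a3^2 - a2^2 is then an equality exactly when the two squares have opposite signs. For w z =
    c z with |c| = 1, a2^2 carries the factor c^2 and a3^2 the factor c^4, so c = i reverses one
    sign and keeps the other.

    No power series occur: coefficients are derivatives at 0, obtained either by differentiating a
    functional equation or as means over circles. The bound on c2 comes from an L2 inequality on
    circles, which needs neither Moebius maps nor the quotient w z / z.

    Membership in [class_K] includes univalence, so it has to be proved for the extremal function.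
    Its derivative may have values of negative real part (already for phi z = (1 + z) / (1 - z)),
    hence the argument uses only the sign of Re (1 + z f'' / f'). *)

Definition has_cderiv (f : C -> C) (z l : C) : Prop :=
  forall eps : R, 0 < eps -> exists d : R, 0 < d /\
    forall y : C, Cmod (y - z) < d ->
      Cmod (f y - f z - l * (y - z)) <= eps * Cmod (y - z).

Lemma is_linear_scal_C (V : NormedModule C_AbsRing) (l : V) :
  is_linear (fun y : C_AbsRing => scal y l).
Proof. apply (@is_linear_scal_l C_AbsRing V). Qed.

Lemma has_cderiv_is_derive (f : C -> C) (z l : C) :
  has_cderiv f z l <-> @is_derive C_AbsRing C_NormedModule f z l.
Proof.
  split.
  - intros H. split; [apply is_linear_scal_C|].
    intros x Hx. apply (@is_filter_lim_locally_unique C_AbsRing (AbsRing_NormedModule C_AbsRing)) in Hx.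
    subst x. intros eps. destruct (H eps (cond_pos eps)) as [d [Hd H1]].
    exists (mkposreal d Hd). intros y Hy.
    unfold minus, plus, opp, scal, norm; simpl.
    unfold ball in Hy; simpl in Hy. unfold AbsRing_ball in Hy; simpl in Hy.
    generalize (H1 y Hy). unfold abs; simpl. unfold mult; simpl.
    unfold Cminus. intros H2.
    rewrite (Cmult_comm (y + - z) l). exact H2.
  - intros [_ H] eps Heps.
    specialize (H z (fun P HP => HP) (mkposreal eps Heps)).
    destruct H as [d H]. exists d. split; [apply cond_pos|].
    intros y Hy. generalize (H y Hy).
    unfold minus, plus, opp, scal, norm; simpl.
    unfold abs; simpl. unfold mult; simpl. unfold Cminus.
    rewrite (Cmult_comm (y + - z) l). trivial.
Qed.

(** Analyticity is stated with codomain [C_NormedModule], while the product rule and the inner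
    function of the chain rule take [AbsRing_NormedModule C_AbsRing]. The epsilon-delta form is the
    bridge between the two structures. *)
Lemma has_cderiv_is_derive' (f : C -> C) (z l : C) :
  has_cderiv f z l <-> @is_derive C_AbsRing (AbsRing_NormedModule C_AbsRing) f z l.
Proof.
  split.
  - intros H. split; [apply is_linear_scal_C|].
    intros x Hx. apply (@is_filter_lim_locally_unique C_AbsRing (AbsRing_NormedModule C_AbsRing)) in Hx.
    subst x. intros eps. destruct (H eps (cond_pos eps)) as [d [Hd H1]].
    exists (mkposreal d Hd). intros y Hy.
    generalize (H1 y Hy).
    unfold minus, plus, opp, scal, norm; simpl.
    unfold abs; simpl. unfold mult; simpl.
    unfold Cminus.
    rewrite (Cmult_comm (y + - z) l). trivial.
  - intros [_ H] eps Heps.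
    specialize (H z (fun P HP => HP) (mkposreal eps Heps)).
    destruct H as [d H]. exists d. split; [apply cond_pos|].
    intros y Hy. generalize (H y Hy).
    unfold minus, plus, opp, scal, norm; simpl.
    unfold abs; simpl. unfold mult; simpl. unfold Cminus.
    rewrite (Cmult_comm (y + - z) l). trivial.
Qed.

Lemma has_cderiv_unique (f : C -> C) (z l : C) :
  has_cderiv f z l -> C_derive f z = l.
Proof. intros H. apply is_C_derive_unique. now apply has_cderiv_is_derive. Qed.

Lemma has_cderiv_C_derive (f : C -> C) (z : C) :
  analytic_on_disk f -> unit_disk z -> has_cderiv f z (C_derive f z).
Proof.
  intros H Hz. apply has_cderiv_is_derive. apply C_derive_correct; auto.
Qed.

Lemma analytic_of_has_cderiv (f df : C -> C) :
  (forall z, unit_disk z -> has_cderiv f z (df z)) -> analytic_on_disk f.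
Proof. intros H z Hz. exists (df z). apply has_cderiv_is_derive; auto. Qed.

Lemma has_cderiv_ext_loc (f g : C -> C) (z l : C) (d : R) :
  0 < d -> (forall y, Cmod (y - z) < d -> f y = g y) ->
  has_cderiv f z l -> has_cderiv g z l.
Proof.
  intros Hd E H eps Heps. destruct (H eps Heps) as [e [He H1]].
  exists (Rmin d e). split; [now apply Rmin_glb_lt|].
  intros y Hy. rewrite <- !E.
  - apply H1. eapply Rlt_le_trans; [exact Hy|apply Rmin_r].
  - replace (z - z)%C with (RtoC 0) by ring. now rewrite Cmod_0.
  - eapply Rlt_le_trans; [exact Hy|apply Rmin_l].
Qed.

Lemma has_cderiv_ext (f g : C -> C) (z l : C) :
  (forall y, f y = g y) -> has_cderiv f z l -> has_cderiv g z l.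
Proof. intros E. apply (has_cderiv_ext_loc f g z l 1 Rlt_0_1). auto. Qed.

Lemma has_cderiv_const (c z : C) : has_cderiv (fun _ => c) z 0.
Proof.
  intros eps Heps. exists 1. split; [lra|]. intros y _.
  replace (c - c - 0 * (y - z))%C with (RtoC 0) by ring.
  rewrite Cmod_0. apply Rmult_le_pos; [lra|apply Cmod_ge_0].
Qed.

Lemma has_cderiv_id (z : C) : has_cderiv (fun y => y) z 1.
Proof.
  intros eps Heps. exists 1. split; [lra|]. intros y _.
  replace (y - z - 1 * (y - z))%C with (RtoC 0) by ring.
  rewrite Cmod_0. apply Rmult_le_pos; [lra|apply Cmod_ge_0].
Qed.

Lemma has_cderiv_plus (f g : C -> C) (z l m : C) :
  has_cderiv f z l -> has_cderiv g z m -> has_cderiv (fun y => f y + g y)%C z (l + m).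
Proof.
  rewrite !has_cderiv_is_derive. intros H1 H2.
  exact (@is_derive_plus C_AbsRing C_NormedModule f g z l m H1 H2).
Qed.

Lemma has_cderiv_mult (f g : C -> C) (z l m : C) :
  has_cderiv f z l -> has_cderiv g z m ->
  has_cderiv (fun y => f y * g y)%C z (l * g z + f z * m).
Proof.
  rewrite !has_cderiv_is_derive'. intros H1 H2.
  exact (@is_derive_mult C_AbsRing f g z l m H1 H2 Cmult_comm).
Qed.

Lemma has_cderiv_comp (f g : C -> C) (z l m : C) :
  has_cderiv f (g z) l -> has_cderiv g z m -> has_cderiv (fun y => f (g y)) z (l * m).
Proof.
  rewrite has_cderiv_is_derive. rewrite (has_cderiv_is_derive' g).
  rewrite has_cderiv_is_derive. intros H1 H2.
  rewrite Cmult_comm.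
  exact (@is_derive_comp C_AbsRing C_NormedModule f g z l m H1 H2).
Qed.

Lemma has_cderiv_continuous (f : C -> C) (z l : C) : has_cderiv f z l ->
  forall eps, 0 < eps -> exists d, 0 < d /\
    forall y, Cmod (y - z) < d -> Cmod (f y - f z) < eps.
Proof.
  intros H eps Heps. destruct (H 1 Rlt_0_1) as [d [Hd H1]].
  pose proof (Cmod_ge_0 l) as Hl.
  exists (Rmin d (eps / (2 + Cmod l))). split.
  { apply Rmin_glb_lt; [exact Hd|]. apply Rdiv_lt_0_compat; lra. }
  intros y Hy.
  assert (Hy1 : Cmod (y - z) < d) by (eapply Rlt_le_trans; [exact Hy|apply Rmin_l]).
  assert (Hy2 : Cmod (y - z) < eps / (2 + Cmod l)) by (eapply Rlt_le_trans; [exact Hy|apply Rmin_r]).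
  specialize (H1 y Hy1).
  replace (f y - f z)%C with ((f y - f z - l * (y - z)) + l * (y - z))%C by ring.
  eapply Rle_lt_trans; [apply Cmod_triangle|]. rewrite Cmod_mult.
  pose proof (Cmod_ge_0 (y - z)).
  apply (Rmult_lt_compat_r (2 + Cmod l)) in Hy2; [|lra].
  unfold Rdiv in Hy2. rewrite Rmult_assoc, Rinv_l, Rmult_1_r in Hy2; [|lra].
  nra.
Qed.

Lemma has_cderiv_inv_id (z : C) : z <> 0 -> has_cderiv (fun y => / y)%C z (- (/ z * / z)).
Proof.
  intros Hz eps Heps.
  pose proof (proj1 (Cmod_gt_0 z) Hz) as Hp. set (m := Cmod z) in *.
  (* The error is |y - z|^2 / (|y| m^2). The first bound keeps |y| above m / 2, so the error is at
     most |y - z| times 2 |y - z| / m^3, and the second bound makes this factor at most [eps]. *)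
  exists (Rmin (m / 2) (eps * m * m * m / 2)). split.
  { apply Rmin_glb_lt; [lra|]. assert (0 < m * m * m) by (repeat apply Rmult_lt_0_compat; auto). nra. }
  intros y Hy.
  assert (Hy1 : Cmod (y - z) < m / 2) by (eapply Rlt_le_trans; [exact Hy|apply Rmin_l]).
  assert (Hy2 : Cmod (y - z) < eps * m * m * m / 2) by (eapply Rlt_le_trans; [exact Hy|apply Rmin_r]).
  assert (Hy3 : m / 2 < Cmod y).
  { pose proof (Cmod_triangle y (z - y)) as T.
    replace (y + (z - y))%C with z in T by ring.
    replace (z - y)%C with (- (y - z))%C in T by ring.
    rewrite Cmod_opp in T. fold m in T. lra. }
  assert (Hy0 : y <> 0) by (intro E; rewrite E, Cmod_0 in Hy3; lra).
  replace (/ y - / z - - (/ z * / z) * (y - z))%C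
    with ((y - z) * ((y - z) * / (y * (z * z))))%C by (field; auto).
  rewrite !Cmod_mult, Cmod_inv, !Cmod_mult; fold m.
  2:{ repeat apply Cmult_neq_0; auto. }
  pose proof (Cmod_ge_0 (y - z)) as H0.
  rewrite (Rmult_comm eps).
  apply Rmult_le_compat_l; [exact H0|].
  assert (Hm : 0 < m * m) by nra.
  apply Rle_trans with (eps * m * m * m / 2 * / (m / 2 * (m * m))).
  - apply Rmult_le_compat; [exact H0| |lra|].
    + left. apply Rinv_0_lt_compat. nra.
    + apply Rinv_le_contravar; nra.
  - right. field. lra.
Qed.

Lemma has_cderiv_eq (f : C -> C) (z l m : C) : l = m -> has_cderiv f z l -> has_cderiv f z m.
Proof. now intros ->. Qed.

(** * Paths and their integrals *)

(** Componentwise, so that real integration, the mean value theorem and monotonicity apply to each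
    coordinate; [path_deriv_eps] supplies the modulus form that the chain rule with [has_cderiv]
    needs. *)
Definition path_deriv (g : R -> C) (t : R) (l : C) : Prop :=
  is_derive (fun s => Re (g s)) t (Re l) /\ is_derive (fun s => Im (g s)) t (Im l).

Definition path_cont (g : R -> C) (t : R) : Prop :=
  continuous (fun s => Re (g s)) t /\ continuous (fun s => Im (g s)) t.

Lemma C_ext (z w : C) : Re z = Re w -> Im z = Im w -> z = w.
Proof. destruct z, w; simpl; intros -> ->; reflexivity. Qed.

Lemma Cmod_le_Re_Im (z : C) : Cmod z <= Rabs (Re z) + Rabs (Im z).
Proof.
  replace z with (RtoC (Re z) + Ci * RtoC (Im z))%C at 1.
  2:{ apply C_ext; simpl; ring. }
  eapply Rle_trans; [apply Cmod_triangle|].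
  rewrite Cmod_mult, Cmod_Ci, !Cmod_R. lra.
Qed.

Lemma Im_le_Cmod (z : C) : Rabs (Im z) <= Cmod z.
Proof. eapply Rle_trans; [apply Rmax_r|apply (Rmax_Cmod z)]. Qed.

Lemma is_derive_eps (f : R -> R) (t l : R) :
  is_derive f t l <->
  (forall eps, 0 < eps -> exists d, 0 < d /\ forall s, Rabs (s - t) < d ->
     Rabs (f s - f t - l * (s - t)) <= eps * Rabs (s - t)).
Proof.
  split.
  - intros [_ H] eps Heps.
    destruct (H t (fun P HP => HP) (mkposreal eps Heps)) as [d Hd].
    exists d. split; [apply cond_pos|]. intros s Hs.
    generalize (Hd s Hs). unfold minus, plus, opp, scal, norm; simpl.
    unfold abs; simpl. unfold mult; simpl. unfold Rminus.
    now rewrite (Rmult_comm l).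
  - intros H. split; [apply (@is_linear_scal_l R_AbsRing R_NormedModule)|].
    intros x Hx.
    apply (@is_filter_lim_locally_unique R_AbsRing R_NormedModule) in Hx. subst x.
    intros eps. destruct (H eps (cond_pos eps)) as [d [Hd H1]].
    exists (mkposreal d Hd). intros s Hs. generalize (H1 s Hs).
    unfold minus, plus, opp, scal, norm; simpl.
    unfold abs; simpl. unfold mult; simpl. unfold Rminus.
    now rewrite (Rmult_comm l).
Qed.

Lemma path_deriv_eps (g : R -> C) (t : R) (l : C) :
  path_deriv g t l <->
  (forall eps, 0 < eps -> exists d, 0 < d /\ forall s, Rabs (s - t) < d ->
     Cmod (g s - g t - l * RtoC (s - t)) <= eps * Rabs (s - t)).
Proof.
  unfold path_deriv. rewrite !is_derive_eps. split.
  - intros [H1 H2] eps Heps.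
    destruct (H1 (eps / 2)) as [d1 [Hd1 K1]]; [lra|].
    destruct (H2 (eps / 2)) as [d2 [Hd2 K2]]; [lra|].
    exists (Rmin d1 d2). split; [now apply Rmin_glb_lt|]. intros s Hs.
    eapply Rle_trans; [apply Cmod_le_Re_Im|].
    assert (Rabs (s - t) < d1) by (eapply Rlt_le_trans; [exact Hs|apply Rmin_l]).
    assert (Rabs (s - t) < d2) by (eapply Rlt_le_trans; [exact Hs|apply Rmin_r]).
    specialize (K1 s H). specialize (K2 s H0).
    replace (Re (g s - g t - l * RtoC (s - t))) with (Re (g s) - Re (g t) - Re l * (s - t)) by (unfold Re; simpl; ring).
    replace (Im (g s - g t - l * RtoC (s - t))) with (Im (g s) - Im (g t) - Im l * (s - t)) by (unfold Im; simpl; ring).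
    lra.
  - intros H. split; intros eps Heps; destruct (H eps Heps) as [d [Hd K]];
    exists d; (split; [exact Hd|]); intros s Hs; (eapply Rle_trans; [|apply (K s Hs)]).
    + eapply Rle_trans; [|apply re_le_Cmod]. right. f_equal. unfold Re; simpl; ring.
    + eapply Rle_trans; [|apply Im_le_Cmod]. right. f_equal. unfold Im; simpl; ring.
Qed.

Lemma path_cont_eps (g : R -> C) (t : R) :
  path_cont g t <->
  (forall eps, 0 < eps -> exists d, 0 < d /\ forall s, Rabs (s - t) < d ->
     Cmod (g s - g t) < eps).
Proof.
  split.
  - intros [H1 H2] eps Heps.
    apply continuity_pt_filterlim in H1. apply continuity_pt_filterlim in H2.
    assert (He : 0 < eps / 2) by lra.
    destruct (proj1 (continuity_pt_locally _ _) H1 (mkposreal _ He)) as [d1 K1].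
    destruct (proj1 (continuity_pt_locally _ _) H2 (mkposreal _ He)) as [d2 K2].
    exists (Rmin d1 d2). split; [apply Rmin_glb_lt; apply cond_pos|]. intros s Hs.
    eapply Rle_lt_trans; [apply Cmod_le_Re_Im|].
    assert (L1 : Rabs (s - t) < d1) by (eapply Rlt_le_trans; [exact Hs|apply Rmin_l]).
    assert (L2 : Rabs (s - t) < d2) by (eapply Rlt_le_trans; [exact Hs|apply Rmin_r]).
    specialize (K1 s L1). specialize (K2 s L2). simpl in K1, K2.
    replace (Re (g s - g t)) with (Re (g s) - Re (g t)) by (unfold Re; simpl; ring).
    replace (Im (g s - g t)) with (Im (g s) - Im (g t)) by (unfold Im; simpl; ring).
    lra.
  - intros H. split; apply continuity_pt_filterlim; apply continuity_pt_locally; intros eps;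
    destruct (H eps (cond_pos eps)) as [d [Hd K]]; exists (mkposreal d Hd); intros s Hs;
    (eapply Rle_lt_trans; [|apply (K s Hs)]).
    + eapply Rle_trans; [|apply re_le_Cmod]. right. f_equal.
    + eapply Rle_trans; [|apply Im_le_Cmod]. right. f_equal.
Qed.

Lemma path_deriv_cont (g : R -> C) (t : R) (l : C) : path_deriv g t l -> path_cont g t.
Proof.
  intros [H1 H2]. split.
  - apply (@ex_derive_continuous R_AbsRing R_NormedModule). eexists; exact H1.
  - apply (@ex_derive_continuous R_AbsRing R_NormedModule). eexists; exact H2.
Qed.

Lemma path_cont_comp (f : C -> C) (g : R -> C) (t : R) (l : C) :
  has_cderiv f (g t) l -> path_cont g t -> path_cont (fun s => f (g s)) t.
Proof.
  intros Hf Hg. apply path_cont_eps. intros eps Heps.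
  destruct (has_cderiv_continuous _ _ _ Hf eps Heps) as [e [He K]].
  destruct (proj1 (path_cont_eps g t) Hg e He) as [d [Hd L]].
  exists d. split; [exact Hd|]. intros s Hs. apply K. now apply L.
Qed.

Lemma path_deriv_comp (f : C -> C) (g : R -> C) (t : R) (l m : C) :
  has_cderiv f (g t) l -> path_deriv g t m -> path_deriv (fun s => f (g s)) t (l * m).
Proof.
  intros Hf Hg. pose proof (path_deriv_cont _ _ _ Hg) as Hc.
  rewrite path_deriv_eps in Hg. rewrite path_cont_eps in Hc.
  apply path_deriv_eps. intros eps Heps.
  pose proof (Cmod_ge_0 l) as Hl. pose proof (Cmod_ge_0 m) as Hm.
  (* The outer error is [e1] times |g s - g t|, the inner error [e2] is multiplied by |l|, and each
     receives half of [eps]. Capping [e2] by 1 gives the Lipschitz bound |g s - g t| <= (1 + |m|) |s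
     - t|. *)
  set (e1 := eps / 2 / (2 + Cmod m)).
  assert (He1 : 0 < e1) by (unfold e1; apply Rdiv_lt_0_compat; lra).
  destruct (Hf e1 He1) as [d1 [Hd1 K1]].
  destruct (Hc d1 Hd1) as [d2 [Hd2 K2]].
  set (e2 := Rmin 1 (eps / 2 / (1 + Cmod l))).
  assert (He2 : 0 < e2) by (unfold e2; apply Rmin_glb_lt; [lra|apply Rdiv_lt_0_compat; lra]).
  destruct (Hg e2 He2) as [d3 [Hd3 K3]].
  exists (Rmin d2 d3). split; [now apply Rmin_glb_lt|]. intros s Hs.
  assert (L2 : Rabs (s - t) < d2) by (eapply Rlt_le_trans; [exact Hs|apply Rmin_l]).
  assert (L3 : Rabs (s - t) < d3) by (eapply Rlt_le_trans; [exact Hs|apply Rmin_r]).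
  specialize (K1 _ (K2 s L2)). specialize (K3 s L3).
  replace (f (g s) - f (g t) - l * m * RtoC (s - t))%C
    with ((f (g s) - f (g t) - l * (g s - g t)) + l * (g s - g t - m * RtoC (s - t)))%C by ring.
  eapply Rle_trans; [apply Cmod_triangle|]. rewrite Cmod_mult.
  assert (G : Cmod (g s - g t) <= (1 + Cmod m) * Rabs (s - t)).
  { replace (g s - g t)%C with ((g s - g t - m * RtoC (s - t)) + m * RtoC (s - t))%C by ring.
    eapply Rle_trans; [apply Cmod_triangle|]. rewrite Cmod_mult, Cmod_R.
    assert (e2 <= 1) by apply Rmin_l. pose proof (Rabs_pos (s - t)). nra. }
  assert (E1 : e1 * (1 + Cmod m) <= eps / 2).
  { apply Rle_trans with (e1 * (2 + Cmod m)); [apply Rmult_le_compat_l; lra|]. right. unfold e1. field. lra. }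
  assert (E2 : Cmod l * e2 <= eps / 2).
  { apply Rle_trans with ((1 + Cmod l) * (eps / 2 / (1 + Cmod l))).
    - apply Rmult_le_compat; try lra. apply Rmin_r.
    - right. field. lra. }
  pose proof (Rabs_pos (s - t)) as Hs0.
  apply Rle_trans with (e1 * ((1 + Cmod m) * Rabs (s - t)) + Cmod l * (e2 * Rabs (s - t))).
  - apply Rplus_le_compat.
    + eapply Rle_trans; [exact K1|]. apply Rmult_le_compat_l; lra.
    + apply Rmult_le_compat_l; assumption.
  - nra.
Qed.

Lemma path_cont_const (c : C) (t : R) : path_cont (fun _ => c) t.
Proof. split; apply continuous_const. Qed.

Lemma path_cont_plus (f g : R -> C) (t : R) :
  path_cont f t -> path_cont g t -> path_cont (fun s => f s + g s)%C t.
Proof.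
  intros [F1 F2] [G1 G2]. split.
  - apply (continuous_plus (fun s => Re (f s)) (fun s => Re (g s))); assumption.
  - apply (continuous_plus (fun s => Im (f s)) (fun s => Im (g s))); assumption.
Qed.

Lemma path_cont_mult (f g : R -> C) (t : R) :
  path_cont f t -> path_cont g t -> path_cont (fun s => f s * g s)%C t.
Proof.
  intros [F1 F2] [G1 G2]. split.
  - apply (continuous_minus (fun s => Re (f s) * Re (g s)) (fun s => Im (f s) * Im (g s)));
    apply @continuous_mult; assumption.
  - apply (continuous_plus (fun s => Re (f s) * Im (g s)) (fun s => Im (f s) * Re (g s)));
    apply @continuous_mult; assumption.
Qed.

Lemma path_cont_conj (f : R -> C) (t : R) : path_cont f t -> path_cont (fun s => Cconj (f s)) t.
Proof.
  intros [F1 F2]. split; [exact F1|].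
  apply (continuous_opp (fun s => Im (f s))). exact F2.
Qed.

Lemma path_deriv_const (c : C) (t : R) : path_deriv (fun _ => c) t 0.
Proof. split; apply @is_derive_const. Qed.

Lemma path_deriv_RtoC (t : R) : path_deriv RtoC t 1.
Proof.
  split; [exact (@is_derive_id R_AbsRing t)|exact (@is_derive_const R_AbsRing R_NormedModule 0 t)].
Qed.

Lemma path_deriv_plus (f g : R -> C) (t : R) (l m : C) :
  path_deriv f t l -> path_deriv g t m -> path_deriv (fun s => f s + g s)%C t (l + m).
Proof.
  intros [F1 F2] [G1 G2]. split.
  - apply (is_derive_plus (fun s => Re (f s)) (fun s => Re (g s))); assumption.
  - apply (is_derive_plus (fun s => Im (f s)) (fun s => Im (g s))); assumption.
Qed.

Lemma path_deriv_eq (f : R -> C) (t : R) (l m : C) : l = m -> path_deriv f t l -> path_deriv f t m.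
Proof. now intros ->. Qed.

Lemma path_deriv_mult (f g : R -> C) (t : R) (l m : C) :
  path_deriv f t l -> path_deriv g t m ->
  path_deriv (fun s => f s * g s)%C t (l * g t + f t * m).
Proof.
  intros [F1 F2] [G1 G2]. split.
  - replace (Re (l * g t + f t * m)) with
      ((Re l * Re (g t) + Re (f t) * Re m) - (Im l * Im (g t) + Im (f t) * Im m))
      by (unfold Re, Im; simpl; ring).
    apply (is_derive_minus (fun s => Re (f s) * Re (g s)) (fun s => Im (f s) * Im (g s)));
    apply (@is_derive_mult R_AbsRing); auto; exact Rmult_comm.
  - replace (Im (l * g t + f t * m)) with
      ((Re l * Im (g t) + Re (f t) * Im m) + (Im l * Re (g t) + Im (f t) * Re m))
      by (unfold Re, Im; simpl; ring).
    apply (is_derive_plus (fun s => Re (f s) * Im (g s)) (fun s => Im (f s) * Re (g s)));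
    apply (@is_derive_mult R_AbsRing); auto; exact Rmult_comm.
Qed.

Lemma path_cont_ext (f g : R -> C) (t : R) : (forall s, f s = g s) -> path_cont f t -> path_cont g t.
Proof.
  intros E [H1 H2]. split.
  - apply (continuous_ext (fun s => Re (f s))); [intros; now rewrite E|exact H1].
  - apply (continuous_ext (fun s => Im (f s))); [intros; now rewrite E|exact H2].
Qed.

Definition CInt (f : R -> C) (a b : R) : C :=
  (RInt (fun t => Re (f t)) a b, RInt (fun t => Im (f t)) a b).

Definition cont_on (f : R -> C) (a b : R) : Prop :=
  forall t, a <= t <= b -> path_cont f t.

Lemma cont_on_ex_RInt_Re (f : R -> C) (a b : R) : a <= b -> cont_on f a b ->
  ex_RInt (fun t => Re (f t)) a b.
Proof.
  intros Hab H. apply (@ex_RInt_continuous R_CompleteNormedModule).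
  rewrite Rmin_left, Rmax_right by assumption. intros t Ht. apply (H t Ht).
Qed.

Lemma cont_on_ex_RInt_Im (f : R -> C) (a b : R) : a <= b -> cont_on f a b ->
  ex_RInt (fun t => Im (f t)) a b.
Proof.
  intros Hab H. apply (@ex_RInt_continuous R_CompleteNormedModule).
  rewrite Rmin_left, Rmax_right by assumption. intros t Ht. apply (H t Ht).
Qed.

Lemma CInt_ext (f g : R -> C) (a b : R) : a <= b ->
  (forall t, a <= t <= b -> f t = g t) -> CInt f a b = CInt g a b.
Proof.
  intros Hab E. unfold CInt. f_equal; apply RInt_ext;
  rewrite Rmin_left, Rmax_right by assumption; intros t Ht; rewrite E; auto; lra.
Qed.

Lemma CInt_plus (f g : R -> C) (a b : R) : a <= b -> cont_on f a b -> cont_on g a b ->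
  CInt (fun t => f t + g t)%C a b = (CInt f a b + CInt g a b)%C.
Proof.
  intros Hab Hf Hg. unfold CInt. apply C_ext; simpl.
  - apply (RInt_plus (fun t => Re (f t)) (fun t => Re (g t))); apply cont_on_ex_RInt_Re; assumption.
  - apply (RInt_plus (fun t => Im (f t)) (fun t => Im (g t))); apply cont_on_ex_RInt_Im; assumption.
Qed.

Lemma CInt_scal (c : C) (f : R -> C) (a b : R) : a <= b -> cont_on f a b ->
  CInt (fun t => c * f t)%C a b = (c * CInt f a b)%C.
Proof.
  intros Hab Hf. unfold CInt.
  pose proof (cont_on_ex_RInt_Re f a b Hab Hf) as H1.
  pose proof (cont_on_ex_RInt_Im f a b Hab Hf) as H2.
  assert (S1 : forall k, ex_RInt (fun t => k * Re (f t)) a b)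
    by (intro k; exact (@ex_RInt_scal R_NormedModule (fun t => Re (f t)) a b k H1)).
  assert (S2 : forall k, ex_RInt (fun t => k * Im (f t)) a b)
    by (intro k; exact (@ex_RInt_scal R_NormedModule (fun t => Im (f t)) a b k H2)).
  assert (E1 : forall k, RInt (fun t => k * Re (f t)) a b = k * RInt (fun t => Re (f t)) a b)
    by (intro k; exact (@RInt_scal R_CompleteNormedModule (fun t => Re (f t)) a b k H1)).
  assert (E2 : forall k, RInt (fun t => k * Im (f t)) a b = k * RInt (fun t => Im (f t)) a b)
    by (intro k; exact (@RInt_scal R_CompleteNormedModule (fun t => Im (f t)) a b k H2)).
  apply C_ext; simpl.
  - rewrite <- E1, <- E2.
    apply (@RInt_minus R_CompleteNormedModule (fun t => Re c * Re (f t)) (fun t => Im c * Im (f t))); auto.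
  - rewrite <- E1, <- E2.
    apply (@RInt_plus R_CompleteNormedModule (fun t => Re c * Im (f t)) (fun t => Im c * Re (f t))); auto.
Qed.

Lemma CInt_minus (f g : R -> C) (a b : R) : a <= b -> cont_on f a b -> cont_on g a b ->
  CInt (fun t => f t - g t)%C a b = (CInt f a b - CInt g a b)%C.
Proof.
  intros Hab Hf Hg. unfold CInt. apply C_ext; simpl.
  - apply (RInt_minus (fun t => Re (f t)) (fun t => Re (g t))); apply cont_on_ex_RInt_Re; assumption.
  - apply (RInt_minus (fun t => Im (f t)) (fun t => Im (g t))); apply cont_on_ex_RInt_Im; assumption.
Qed.

Lemma CInt_const (c : C) (a b : R) : CInt (fun _ => c) a b = (RtoC (b - a) * c)%C.
Proof.
  unfold CInt. rewrite !RInt_const. unfold scal; simpl. unfold mult; simpl.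
  apply C_ext; simpl; unfold Re, Im; ring.
Qed.

Lemma CInt_deriv (F f : R -> C) (a b : R) : a <= b ->
  (forall t, a <= t <= b -> path_deriv F t (f t)) -> cont_on f a b ->
  CInt f a b = (F b - F a)%C.
Proof.
  intros Hab HF Hf. unfold CInt. apply C_ext; simpl; apply is_RInt_unique.
  - apply (@is_RInt_derive R_CompleteNormedModule (fun t => Re (F t)) (fun t => Re (f t)));
    rewrite Rmin_left, Rmax_right by assumption; intros t Ht.
    + apply (HF t Ht).
    + apply (Hf t Ht).
  - apply (@is_RInt_derive R_CompleteNormedModule (fun t => Im (F t)) (fun t => Im (f t)));
    rewrite Rmin_left, Rmax_right by assumption; intros t Ht.
    + apply (HF t Ht).
    + apply (Hf t Ht).
Qed.

(** The factor 2 comes from estimating real and imaginary parts separately. It is harmless, since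
    the bound only serves in errors that are made arbitrarily small. *)
Lemma CInt_bound (f : R -> C) (a b M : R) : a <= b -> cont_on f a b ->
  (forall t, a <= t <= b -> Cmod (f t) <= M) -> Cmod (CInt f a b) <= 2 * (b - a) * M.
Proof.
  intros Hab Hf HM.
  assert (B : forall g : R -> R, ex_RInt g a b -> (forall t, a <= t <= b -> Rabs (g t) <= M) ->
    Rabs (RInt g a b) <= (b - a) * M).
  { intros g Hg Hb. now apply abs_RInt_le_const. }
  eapply Rle_trans; [apply Cmod_le_Re_Im|]. unfold CInt.
  assert (B1 := B _ (cont_on_ex_RInt_Re f a b Hab Hf)).
  assert (B2 := B _ (cont_on_ex_RInt_Im f a b Hab Hf)).
  simpl.
  assert (Rabs (RInt (fun t => Re (f t)) a b) <= (b - a) * M).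
  { apply B1. intros t Ht. eapply Rle_trans; [apply re_le_Cmod|auto]. }
  assert (Rabs (RInt (fun t => Im (f t)) a b) <= (b - a) * M).
  { apply B2. intros t Ht. eapply Rle_trans; [apply Im_le_Cmod|auto]. }
  lra.
Qed.

Lemma CInt_Chasles (f : R -> C) (a b c : R) : a <= b -> b <= c -> cont_on f a c ->
  (CInt f a b + CInt f b c)%C = CInt f a c.
Proof.
  intros H1 H2 Hf.
  assert (Hab : cont_on f a b) by (intros t Ht; apply Hf; lra).
  assert (Hbc : cont_on f b c) by (intros t Ht; apply Hf; lra).
  unfold CInt. apply C_ext; simpl.
  - apply (@RInt_Chasles R_CompleteNormedModule (fun t => Re (f t))); apply cont_on_ex_RInt_Re; assumption.
  - apply (@RInt_Chasles R_CompleteNormedModule (fun t => Im (f t))); apply cont_on_ex_RInt_Im; assumption.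
Qed.

Lemma CInt_comp_lin (f : R -> C) (u v a b : R) : 0 < u -> a <= b ->
  cont_on f (u * a + v) (u * b + v) ->
  (RtoC u * CInt (fun t => f (u * t + v)%R) a b)%C = CInt f (u * a + v) (u * b + v).
Proof.
  intros Hu Hab Hf.
  assert (Hle : u * a + v <= u * b + v) by nra.
  unfold CInt. apply C_ext; simpl.
  - rewrite <- (@RInt_comp_lin R_CompleteNormedModule (fun t => Re (f t)) u v a b
      (cont_on_ex_RInt_Re f _ _ Hle Hf)).
    rewrite (@RInt_scal R_CompleteNormedModule (fun t => Re (f (u * t + v)))).
    + unfold scal; simpl. unfold mult; simpl. ring.
    + apply (@ex_RInt_continuous R_CompleteNormedModule (fun t => Re (f (u * t + v)))).
      rewrite Rmin_left, Rmax_right by assumption. intros t Ht.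
      apply (continuous_comp (fun t => u * t + v) (fun x => Re (f x))).
      * apply (@ex_derive_continuous R_AbsRing R_NormedModule). auto_derive. trivial.
      * apply (Hf (u * t + v)). nra.
  - rewrite <- (@RInt_comp_lin R_CompleteNormedModule (fun t => Im (f t)) u v a b
      (cont_on_ex_RInt_Im f _ _ Hle Hf)).
    rewrite (@RInt_scal R_CompleteNormedModule (fun t => Im (f (u * t + v)))).
    + unfold scal; simpl. unfold mult; simpl. ring.
    + apply (@ex_RInt_continuous R_CompleteNormedModule (fun t => Im (f (u * t + v)))).
      rewrite Rmin_left, Rmax_right by assumption. intros t Ht.
      apply (continuous_comp (fun t => u * t + v) (fun x => Im (f x))).
      * apply (@ex_derive_continuous R_AbsRing R_NormedModule). auto_derive. trivial.
      * apply (Hf (u * t + v)). nra.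
Qed.

(** * Goursat's lemma and primitives *)

Definition seg (a b : C) (t : R) : C := (a + RtoC t * (b - a))%C.

Definition SInt (f : C -> C) (a b : C) : C :=
  ((b - a) * CInt (fun t => f (seg a b t)) 0 1)%C.

Lemma seg_Cmod (a b z : C) (t r : R) : 0 <= t <= 1 ->
  Cmod (a - z) <= r -> Cmod (b - z) <= r -> Cmod (seg a b t - z) <= r.
Proof.
  intros Ht Ha Hb. unfold seg.
  replace (a + RtoC t * (b - a) - z)%C with (RtoC (1 - t) * (a - z) + RtoC t * (b - z))%C
    by (rewrite RtoC_minus; ring).
  eapply Rle_trans; [apply Cmod_triangle|]. rewrite !Cmod_mult, !Cmod_R, !Rabs_pos_eq by lra.
  nra.
Qed.

Lemma seg_Cmod0 (a b : C) (t r : R) : 0 <= t <= 1 ->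
  Cmod a <= r -> Cmod b <= r -> Cmod (seg a b t) <= r.
Proof.
  intros Ht Ha Hb. pose proof (seg_Cmod a b 0 t r Ht) as H.
  assert (E : forall w : C, (w - 0)%C = w) by (intro; ring).
  rewrite !E in H. auto.
Qed.

Lemma path_deriv_seg (a b : C) (t : R) : path_deriv (seg a b) t (b - a).
Proof.
  unfold seg. eapply path_deriv_eq.
  2:{ apply path_deriv_plus; [apply path_deriv_const|].
      apply path_deriv_mult; [apply path_deriv_RtoC|apply path_deriv_const]. }
  simpl. ring.
Qed.

Lemma path_cont_seg (a b : C) (t : R) : path_cont (seg a b) t.
Proof. eapply path_deriv_cont, path_deriv_seg. Qed.

Lemma SInt_primitive (P g : C -> C) (a b : C) :
  (forall t, 0 <= t <= 1 -> has_cderiv P (seg a b t) (g (seg a b t))) ->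
  cont_on (fun t => g (seg a b t)) 0 1 ->
  SInt g a b = (P b - P a)%C.
Proof.
  intros HP Hg. unfold SInt. rewrite <- CInt_scal; [|lra|exact Hg].
  rewrite (CInt_deriv (fun t => P (seg a b t))); try lra.
  - f_equal; [|f_equal]; f_equal; unfold seg; simpl; ring.
  - intros t Ht. eapply path_deriv_eq; [|apply path_deriv_comp; [apply HP, Ht|apply path_deriv_seg]].
    apply Cmult_comm.
  - intros t Ht. apply path_cont_mult; [apply path_cont_const|apply Hg, Ht].
Qed.

Lemma SInt_bound (f : C -> C) (a b : C) (M : R) :
  cont_on (fun t => f (seg a b t)) 0 1 ->
  (forall t, 0 <= t <= 1 -> Cmod (f (seg a b t)) <= M) ->
  Cmod (SInt f a b) <= Cmod (b - a) * (2 * M).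
Proof.
  intros Hc HM. unfold SInt. rewrite Cmod_mult.
  apply Rmult_le_compat_l; [apply Cmod_ge_0|].
  eapply Rle_trans; [apply CInt_bound with (M := M); auto; lra|]. right; ring.
Qed.

Lemma SInt_minus (f g : C -> C) (a b : C) :
  cont_on (fun t => f (seg a b t)) 0 1 -> cont_on (fun t => g (seg a b t)) 0 1 ->
  SInt (fun z => f z - g z)%C a b = (SInt f a b - SInt g a b)%C.
Proof.
  intros Hf Hg. unfold SInt. rewrite CInt_minus; auto; [ring|lra].
Qed.

Lemma RInt_reverse (f : R -> R) : ex_RInt f 0 1 ->
  RInt (fun t => f (1 - t)) 0 1 = RInt f 0 1.
Proof.
  intros H. apply ex_RInt_swap in H.
  pose proof (@RInt_comp_lin R_CompleteNormedModule f (-1) 1 0 1) as K.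
  replace (-1 * 0 + 1) with 1 in K by ring. replace (-1 * 1 + 1) with 0 in K by ring.
  specialize (K H).
  assert (E : RInt (fun t => f (1 - t)) 0 1 = - RInt (fun y => scal (-1) (f (-1 * y + 1))) 0 1).
  { transitivity (RInt (fun t => opp (scal (-1) (f (-1 * t + 1)))) 0 1).
    - apply RInt_ext. intros t _. unfold opp, scal; simpl. unfold mult; simpl.
      replace (-1 * t + 1) with (1 - t) by ring. ring.
    - apply (@RInt_opp R_CompleteNormedModule (fun t => scal (-1) (f (-1 * t + 1)))).
      apply (@ex_RInt_comp_lin R_NormedModule f (-1) 1 0 1).
      replace (-1 * 0 + 1) with 1 by ring. replace (-1 * 1 + 1) with 0 by ring. exact H. }
  rewrite E. transitivity (- RInt f 1 0); [f_equal; exact K|].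
  exact (@opp_RInt_swap R_CompleteNormedModule f 1 0 H).
Qed.

Lemma SInt_swap (f : C -> C) (a b : C) : cont_on (fun t => f (seg a b t)) 0 1 ->
  SInt f b a = (- SInt f a b)%C.
Proof.
  intros Hf. unfold SInt.
  replace (CInt (fun t => f (seg b a t)) 0 1) with (CInt (fun t => f (seg a b t)) 0 1).
  { ring. }
  transitivity (CInt (fun t => f (seg a b (1 - t)%R)) 0 1).
  - unfold CInt. f_equal; symmetry.
    + apply (RInt_reverse (fun t => Re (f (seg a b t)))). apply cont_on_ex_RInt_Re; [lra|exact Hf].
    + apply (RInt_reverse (fun t => Im (f (seg a b t)))). apply cont_on_ex_RInt_Im; [lra|exact Hf].
  - apply CInt_ext; [lra|]. intros t _. f_equal. unfold seg. rewrite RtoC_minus. ring.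
Qed.

(** Multiplying by [RtoC (/ 2)] leaves midpoint identities to [ring], with [half_half] as the only
    extra relation. *)
Definition mid (a b : C) : C := ((a + b) * RtoC (/ 2))%C.

Lemma half_half : (RtoC (/ 2) + RtoC (/ 2) = 1)%C.
Proof. apply C_ext; simpl; lra. Qed.

Lemma mid_l (a b : C) : (mid a b - a = RtoC (/ 2) * (b - a))%C.
Proof.
  unfold mid. replace a with (a * (RtoC (/ 2) + RtoC (/ 2)))%C at 2; [ring|].
  rewrite half_half; ring.
Qed.

Lemma mid_r (a b : C) : (b - mid a b = RtoC (/ 2) * (b - a))%C.
Proof.
  unfold mid. replace b with (b * (RtoC (/ 2) + RtoC (/ 2)))%C at 1; [ring|].
  rewrite half_half; ring.
Qed.

Lemma mid_Cmod (a b : C) (r : R) : Cmod a <= r -> Cmod b <= r -> Cmod (mid a b) <= r.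
Proof.
  intros Ha Hb. unfold mid. rewrite Cmod_mult, Cmod_R, Rabs_pos_eq by lra.
  pose proof (Cmod_triangle a b). lra.
Qed.

Lemma SInt_mid (f : C -> C) (a b : C) : cont_on (fun t => f (seg a b t)) 0 1 ->
  SInt f a b = (SInt f a (mid a b) + SInt f (mid a b) b)%C.
Proof.
  intros Hf. unfold SInt. rewrite mid_l, mid_r.
  rewrite <- (CInt_Chasles (fun t => f (seg a b t)) 0 (/ 2) 1); try lra; try exact Hf.
  pose proof (CInt_comp_lin (fun t => f (seg a b t)) (/ 2) 0 0 1) as K1.
  pose proof (CInt_comp_lin (fun t => f (seg a b t)) (/ 2) (/ 2) 0 1) as K2.
  replace (/ 2 * 0 + 0) with 0 in K1 by ring. replace (/ 2 * 1 + 0) with (/ 2) in K1 by ring.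
  replace (/ 2 * 0 + / 2) with (/ 2) in K2 by ring. replace (/ 2 * 1 + / 2) with 1 in K2 by field.
  rewrite <- K1, <- K2; try lra.
  2:{ intros t Ht. apply Hf. lra. }
  2:{ intros t Ht. apply Hf. lra. }
  rewrite (CInt_ext (fun t => f (seg a (mid a b) t)) (fun t => f (seg a b (/ 2 * t + 0)%R))); [|lra|].
  rewrite (CInt_ext (fun t => f (seg (mid a b) b t)) (fun t => f (seg a b (/ 2 * t + / 2)%R))); [|lra|].
  - ring.
  - intros t _. f_equal. unfold seg. rewrite mid_r.
    replace (mid a b) with (a + RtoC (/ 2) * (b - a))%C by (rewrite <- mid_l; ring).
    rewrite RtoC_plus, RtoC_mult. ring.
  - intros t _. f_equal. unfold seg. rewrite mid_l. rewrite Rplus_0_r, RtoC_mult. ring.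
Qed.

Definition TInt (f : C -> C) (a b c : C) : C := (SInt f a b + SInt f b c + SInt f c a)%C.

Definition perim (a b c : C) : R := Cmod (b - a) + Cmod (c - b) + Cmod (a - c).

(** The affine part f z + l (w - z) has the primitive [P], so it contributes nothing around a closed
    triangle. Only the remainder is left, at most [eps * D] at each point of the sides. *)
Lemma TInt_local (f : C -> C) (a b c z l : C) (eps D : R) :
  (forall w, Cmod (w - z) <= D -> Cmod (f w - f z - l * (w - z)) <= eps * Cmod (w - z)) ->
  (forall p q, Cmod (p - z) <= D -> Cmod (q - z) <= D -> cont_on (fun t => f (seg p q t)) 0 1) ->
  0 <= eps -> Cmod (a - z) <= D -> Cmod (b - z) <= D -> Cmod (c - z) <= D ->
  Cmod (TInt f a b c) <= 2 * eps * D * perim a b c.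
Proof.
  intros Hf Hc Heps Ha Hb Hcc.
  set (g := fun w : C => (f z + l * (w - z))%C).
  set (P := fun w : C => (f z * w + l * (RtoC (/ 2) * (w * w) - z * w))%C).
  assert (HP : forall w, has_cderiv P w (g w)).
  { intros w. unfold P, g.
    eapply has_cderiv_eq.
    2:{ apply has_cderiv_plus; [apply has_cderiv_mult; [apply has_cderiv_const|apply has_cderiv_id]|].
        apply has_cderiv_mult; [apply has_cderiv_const|].
        apply (has_cderiv_plus (fun w => RtoC (/ 2) * (w * w))%C (fun w => - (z * w))%C).
        - apply has_cderiv_mult; [apply has_cderiv_const|].
          apply has_cderiv_mult; apply has_cderiv_id.
        - apply (has_cderiv_ext (fun w => (- z) * w)%C); [intros; ring|].
          apply has_cderiv_mult; [apply has_cderiv_const|apply has_cderiv_id]. }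
    simpl. replace (l * (w - z))%C with (l * (w * (RtoC (/2) + RtoC (/2)) - z))%C; [ring|].
    rewrite half_half; ring. }
  assert (Hg : forall w, has_cderiv g w l).
  { intros w. unfold g. eapply has_cderiv_eq.
    2:{ apply has_cderiv_plus; [apply has_cderiv_const|].
        apply has_cderiv_mult; [apply has_cderiv_const|].
        apply (has_cderiv_plus (fun w => w) (fun _ => - z)%C); [apply has_cderiv_id|apply has_cderiv_const]. }
    simpl. ring. }
  assert (Cg : forall p q, cont_on (fun t => g (seg p q t)) 0 1).
  { intros p q t _. eapply path_cont_comp; [apply Hg|apply path_cont_seg]. }
  assert (S : forall p q, Cmod (p - z) <= D -> Cmod (q - z) <= D ->
    Cmod (SInt f p q - (P q - P p)) <= Cmod (q - p) * (2 * (eps * D))).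
  { intros p q Hp Hq.
    rewrite <- (SInt_primitive P g p q); [|intros; apply HP|apply Cg].
    rewrite <- SInt_minus; [|apply Hc; assumption|apply Cg].
    apply (SInt_bound (fun w => f w - g w)%C).
    - intros t Ht. apply (path_cont_ext (fun t => f (seg p q t) + (- RtoC 1) * g (seg p q t))%C);
        [intros; ring|]. apply path_cont_plus; [apply Hc; assumption|].
      apply path_cont_mult; [apply path_cont_const|apply Cg, Ht].
    - intros t Ht. unfold g.
      pose proof (seg_Cmod p q z t D Ht Hp Hq) as Hs.
      replace (f (seg p q t) - (f z + l * (seg p q t - z)))%C
        with (f (seg p q t) - f z - l * (seg p q t - z))%C by ring.
      eapply Rle_trans; [apply Hf; exact Hs|]. apply Rmult_le_compat_l; assumption. }
  replace (TInt f a b c) with ((SInt f a b - (P b - P a)) + (SInt f b c - (P c - P b))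
     + (SInt f c a - (P a - P c)))%C by (unfold TInt; ring).
  eapply Rle_trans; [apply Cmod_triangle|].
  eapply Rle_trans; [apply Rplus_le_compat_r, Cmod_triangle|].
  pose proof (S a b Ha Hb). pose proof (S b c Hb Hcc). pose proof (S c a Hcc Ha).
  unfold perim. lra.
Qed.

Lemma TInt_subdivide (f : C -> C) (r : R) (a b c : C) :
  (forall p q, Cmod p <= r -> Cmod q <= r -> cont_on (fun t => f (seg p q t)) 0 1) ->
  Cmod a <= r -> Cmod b <= r -> Cmod c <= r ->
  TInt f a b c = (TInt f a (mid a b) (mid c a) + TInt f (mid a b) b (mid b c)
    + TInt f (mid c a) (mid b c) c + TInt f (mid b c) (mid c a) (mid a b))%C.
Proof.
  intros Hc Ha Hb Hcc.
  assert (H1 := mid_Cmod a b r Ha Hb). assert (H2 := mid_Cmod b c r Hb Hcc).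
  assert (H3 := mid_Cmod c a r Hcc Ha).
  unfold TInt.
  rewrite (SInt_mid f a b), (SInt_mid f b c), (SInt_mid f c a) by (apply Hc; assumption).
  rewrite (SInt_swap f (mid a b) (mid c a)), (SInt_swap f (mid b c) (mid a b)),
    (SInt_swap f (mid c a) (mid b c)) by (apply Hc; assumption).
  ring.
Qed.

(** Picks one of the four half-size triangles carrying at least a quarter of |TInt|. The middle one
    needs no test: the four integrals add up to the whole, so it qualifies when the other three
    fail. *)
Definition next_tri (f : C -> C) (T : C * C * C) : C * C * C :=
  let '(a, b, c) := T in
  let q := Cmod (TInt f a b c) / 4 in
  if Rle_dec q (Cmod (TInt f a (mid a b) (mid c a))) then (a, mid a b, mid c a)
  else if Rle_dec q (Cmod (TInt f (mid a b) b (mid b c))) then (mid a b, b, mid b c)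
  else if Rle_dec q (Cmod (TInt f (mid c a) (mid b c) c)) then (mid c a, mid b c, c)
  else (mid b c, mid c a, mid a b).

Lemma mid_side (p q s : C) : Cmod (mid p q - mid p s) = / 2 * Cmod (q - s).
Proof.
  unfold mid. replace ((p + q) * RtoC (/ 2) - (p + s) * RtoC (/ 2))%C
    with (RtoC (/ 2) * (q - s))%C by ring.
  rewrite Cmod_mult, Cmod_R, Rabs_pos_eq; lra.
Qed.

Lemma mid_comm (p q : C) : mid p q = mid q p.
Proof. unfold mid. ring. Qed.

Lemma Cmod_minus_sym (p q : C) : Cmod (p - q) = Cmod (q - p).
Proof. rewrite <- Cmod_opp. f_equal. ring. Qed.

Lemma mid_dist_l (p q : C) : Cmod (mid p q - p) = / 2 * Cmod (q - p).
Proof. rewrite mid_l, Cmod_mult, Cmod_R, Rabs_pos_eq; lra. Qed.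

Lemma mid_dist_r (p q : C) : Cmod (q - mid p q) = / 2 * Cmod (q - p).
Proof. rewrite mid_r, Cmod_mult, Cmod_R, Rabs_pos_eq; lra. Qed.

(** The displacement of the first vertex is recorded because the common point of the nested
    triangles is obtained as the limit of the first vertices. The factor 4 is what the halved
    perimeter and the halved diameter have to compensate. *)
Lemma next_tri_spec (f : C -> C) (r : R) (a b c : C) :
  (forall p q, Cmod p <= r -> Cmod q <= r -> cont_on (fun t => f (seg p q t)) 0 1) ->
  Cmod a <= r -> Cmod b <= r -> Cmod c <= r ->
  let '(a', b', c') := next_tri f (a, b, c) in
  Cmod a' <= r /\ Cmod b' <= r /\ Cmod c' <= r /\
  perim a' b' c' = / 2 * perim a b c /\ Cmod (a' - a) <= perim a b c /\
  Cmod (TInt f a b c) <= 4 * Cmod (TInt f a' b' c').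
Proof.
  intros Hc Ha Hb Hcc.
  pose proof (TInt_subdivide f r a b c Hc Ha Hb Hcc) as HT.
  assert (H1 := mid_Cmod a b r Ha Hb). assert (H2 := mid_Cmod b c r Hb Hcc).
  assert (H3 := mid_Cmod c a r Hcc Ha).
  pose proof (Cmod_ge_0 (b - a)). pose proof (Cmod_ge_0 (c - b)). pose proof (Cmod_ge_0 (a - c)).
  assert (D1 : Cmod (mid a b - a) = / 2 * Cmod (b - a)) by apply mid_dist_l.
  assert (D1' : Cmod (b - mid a b) = / 2 * Cmod (b - a)) by apply mid_dist_r.
  assert (D2 : Cmod (mid b c - b) = / 2 * Cmod (c - b)) by apply mid_dist_l.
  assert (D2' : Cmod (c - mid b c) = / 2 * Cmod (c - b)) by apply mid_dist_r.
  assert (D3 : Cmod (mid c a - c) = / 2 * Cmod (a - c)) by apply mid_dist_l.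
  assert (D3' : Cmod (a - mid c a) = / 2 * Cmod (a - c)) by apply mid_dist_r.
  assert (D4 : Cmod (mid c a - mid a b) = / 2 * Cmod (c - b)).
  { rewrite (mid_comm c a). apply mid_side. }
  assert (D5 : Cmod (mid a b - mid b c) = / 2 * Cmod (a - c)).
  { rewrite (mid_comm a b). apply mid_side. }
  assert (D6 : Cmod (mid b c - mid c a) = / 2 * Cmod (b - a)).
  { rewrite (mid_comm b c). apply mid_side. }
  unfold next_tri.
  destruct (Rle_dec _ _) as [L1|L1].
  { repeat split; auto.
    - unfold perim. lra.
    - replace (a - a)%C with (RtoC 0) by ring. rewrite Cmod_0. unfold perim; lra.
    - lra. }
  destruct (Rle_dec _ _) as [L2|L2].
  { repeat split; auto.
    - unfold perim. rewrite D1', D2, D5. lra.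
    - unfold perim; lra.
    - lra. }
  destruct (Rle_dec _ _) as [L3|L3].
  { repeat split; auto.
    - unfold perim. rewrite D6, D2', D3. lra.
    - rewrite Cmod_minus_sym, D3'. unfold perim; lra.
    - lra. }
  repeat split; auto.
  - unfold perim. rewrite (Cmod_minus_sym (mid c a) (mid b c)), D6,
      (Cmod_minus_sym (mid a b) (mid c a)), D4, (Cmod_minus_sym (mid b c) (mid a b)), D5. lra.
  - replace (mid b c - a)%C with ((mid b c - b) + (b - a))%C by ring.
    eapply Rle_trans; [apply Cmod_triangle|]. unfold perim. lra.
  - pose proof (Cmod_triangle (TInt f a (mid a b) (mid c a) + TInt f (mid a b) b (mid b c)
    + TInt f (mid c a) (mid b c) c) (TInt f (mid b c) (mid c a) (mid a b))) as T1.
    pose proof (Cmod_triangle (TInt f a (mid a b) (mid c a) + TInt f (mid a b) b (mid b c))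
     (TInt f (mid c a) (mid b c) c)) as T2.
    pose proof (Cmod_triangle (TInt f a (mid a b) (mid c a)) (TInt f (mid a b) b (mid b c))) as T3.
    rewrite <- HT in T1. lra.
Qed.

(** Shifting [x n] by 2 K / 2^n down and up gives the endpoints of nested intervals, because the
    tail of the geometric series from n on is exactly 2 K / 2^n. The supremum of the left endpoints
    is the limit, and the rate comes with it. *)
Lemma geometric_Cauchy (x : nat -> R) (K : R) : 
  (forall n, Rabs (x (S n) - x n) <= K * (/ 2) ^ n) ->
  exists l, forall n, Rabs (x n - l) <= 2 * K * (/ 2) ^ n.
Proof.
  intros H.
  set (u := fun n => x n - 2 * K * (/ 2) ^ n). set (v := fun n => x n + 2 * K * (/ 2) ^ n).
  assert (HK : 0 <= K).
  { pose proof (H O) as H0. simpl in H0. pose proof (Rabs_pos (x 1%nat - x O)). lra. }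
  assert (Hu : forall n, u n <= u (S n)).
  { intro n. unfold u. simpl. pose proof (proj1 (Rabs_le_between _ _) (H n)). lra. }
  assert (Hv : forall n, v (S n) <= v n).
  { intro n. unfold v. simpl. pose proof (proj1 (Rabs_le_between _ _) (H n)). lra. }
  assert (Huv : forall n, u n <= v n).
  { intro n. unfold u, v. assert (0 <= (/ 2) ^ n) by (apply pow_le; lra). nra. }
  assert (Mu : forall n k, u n <= u (n + k)%nat).
  { intros n k. induction k; [rewrite Nat.add_0_r; lra|]. rewrite Nat.add_succ_r.
    eapply Rle_trans; [exact IHk|apply Hu]. }
  assert (Mv : forall n k, v (n + k)%nat <= v n).
  { intros n k. induction k; [rewrite Nat.add_0_r; lra|]. rewrite Nat.add_succ_r.
    eapply Rle_trans; [apply Hv|exact IHk]. }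
  assert (Muv : forall n m, u n <= v m).
  { intros n m. eapply Rle_trans; [apply (Mu n m)|]. eapply Rle_trans; [apply Huv|].
    rewrite Nat.add_comm. apply Mv. }
  destruct (completeness (fun y => exists n, y = u n)) as [l [Hl1 Hl2]].
  { exists (v O). intros y [n ->]. apply Muv. }
  { exists (u O). now exists O. }
  exists l. intro n.
  assert (A1 : u n <= l) by (apply Hl1; now exists n).
  assert (A2 : l <= v n) by (apply Hl2; intros y [m ->]; apply Muv).
  apply Rabs_le_between. unfold u, v in *. lra.
Qed.

Lemma goursat_triangle (f : C -> C) (r : R) (a b c : C) :
  analytic_on_disk f -> r < 1 -> Cmod a <= r -> Cmod b <= r -> Cmod c <= r ->
  TInt f a b c = 0.
Proof.
  intros Hf Hr Ha Hb Hcc.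
  assert (Hc : forall p q, Cmod p < 1 -> Cmod q < 1 -> cont_on (fun t => f (seg p q t)) 0 1).
  { intros p q Hp Hq t Ht. eapply path_cont_comp; [|apply path_cont_seg].
    apply has_cderiv_C_derive; [exact Hf|].
    unfold unit_disk. eapply Rle_lt_trans; [apply (seg_Cmod0 p q t (Rmax (Cmod p) (Cmod q)) Ht)|].
    - apply Rmax_l. - apply Rmax_r. - now apply Rmax_lub_lt. }
  assert (Hc' : forall p q, Cmod p <= r -> Cmod q <= r -> cont_on (fun t => f (seg p q t)) 0 1).
  { intros p q Hp Hq. apply Hc; lra. }
  set (tri := fun n => Nat.iter n (next_tri f) (a, b, c)).
  set (A := fun n => fst (fst (tri n))). set (B := fun n => snd (fst (tri n))).
  set (G := fun n => snd (tri n)).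
  set (L := perim a b c).
  assert (Inv : forall n, Cmod (A n) <= r /\ Cmod (B n) <= r /\ Cmod (G n) <= r /\
    perim (A n) (B n) (G n) = L * (/ 2) ^ n /\
    Cmod (A (S n) - A n) <= L * (/ 2) ^ n /\
    Cmod (TInt f a b c) <= 4 ^ n * Cmod (TInt f (A n) (B n) (G n))).
  { assert (Step : forall n, Cmod (A n) <= r -> Cmod (B n) <= r -> Cmod (G n) <= r ->
      Cmod (A (S n)) <= r /\ Cmod (B (S n)) <= r /\ Cmod (G (S n)) <= r /\
      perim (A (S n)) (B (S n)) (G (S n)) = / 2 * perim (A n) (B n) (G n) /\
      Cmod (A (S n) - A n) <= perim (A n) (B n) (G n) /\
      Cmod (TInt f (A n) (B n) (G n)) <= 4 * Cmod (TInt f (A (S n)) (B (S n)) (G (S n)))).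
    { intros n H1 H2 H3.
      pose proof (next_tri_spec f r (A n) (B n) (G n) Hc' H1 H2 H3) as K.
      unfold A, B, G in *. simpl.
      change (Nat.iter n (next_tri f) (a, b, c)) with (tri n) in *.
      destruct (tri n) as [[p q] s]. simpl in *.
      destruct (if Rle_dec _ _ then _ else _) as [[p' q'] s']. exact K. }
    induction n.
    - destruct (Step O Ha Hb Hcc) as [_ [_ [_ [_ [S1 _]]]]].
      simpl pow. rewrite Rmult_1_r, Rmult_1_l.
      repeat split; auto. unfold A, B, G; simpl. lra.
    - destruct IHn as [I1 [I2 [I3 [I4 [_ I6]]]]].
      destruct (Step n I1 I2 I3) as [S1 [S2 [S3 [S4 [_ S6]]]]].
      destruct (Step (S n) S1 S2 S3) as [_ [_ [_ [_ [S5' _]]]]].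
      assert (P4 : perim (A (S n)) (B (S n)) (G (S n)) = L * (/ 2) ^ S n)
        by (rewrite S4, I4; simpl; ring).
      repeat split; auto.
      + rewrite <- P4. exact S5'.
      + eapply Rle_trans; [exact I6|]. simpl.
        assert (0 < 4 ^ n) by (apply pow_lt; lra). nra. }
  destruct (geometric_Cauchy (fun n => Re (A n)) L) as [x Hx].
  { intro n. eapply Rle_trans; [|apply Inv]. eapply Rle_trans; [|apply re_le_Cmod].
    right. f_equal. }
  destruct (geometric_Cauchy (fun n => Im (A n)) L) as [y Hy].
  { intro n. eapply Rle_trans; [|apply Inv]. eapply Rle_trans; [|apply Im_le_Cmod].
    right. f_equal. }
  set (z := (x, y) : C).
  assert (Hz : forall n, Cmod (A n - z) <= 4 * L * (/ 2) ^ n).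
  { intro n. eapply Rle_trans; [apply Cmod_le_Re_Im|].
    specialize (Hx n). specialize (Hy n).
    replace (Re (A n - z)) with (Re (A n) - x) by reflexivity.
    replace (Im (A n - z)) with (Im (A n) - y) by reflexivity. lra. }
  assert (HL : 0 <= L).
  { unfold L, perim. pose proof (Cmod_ge_0 (b - a)). pose proof (Cmod_ge_0 (c - b)).
    pose proof (Cmod_ge_0 (a - c)). lra. }
  (* The first vertex is within 4 L / 2^n of [z] (2 L / 2^n for each coordinate), and the other
     vertices are within the perimeter L / 2^n of the first one: hence the 5. *)
  assert (Small : forall eta, 0 < eta -> exists n, 5 * L * (/ 2) ^ n < eta).
  { intros eta Heta.
    destruct (pow_lt_1_zero (/ 2)) with (y := eta / (5 * L + 1)) as [N HN].
    - rewrite Rabs_pos_eq; lra.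
    - apply Rdiv_lt_0_compat; lra.
    - exists N. specialize (HN N (le_n N)).
      assert (P : 0 < (/ 2) ^ N) by (apply pow_lt; lra).
      rewrite Rabs_pos_eq in HN by lra.
      apply (Rmult_lt_compat_r (5 * L + 1)) in HN; [|lra].
      unfold Rdiv in HN. rewrite Rmult_assoc, Rinv_l, Rmult_1_r in HN by lra. nra. }
  assert (Hzr : Cmod z < 1).
  { destruct (Small (1 - r)) as [n Hn]; [lra|].
    pose proof (Hz n) as H1. destruct (Inv n) as [H2 _].
    pose proof (Cmod_triangle (A n) (z - A n)) as T.
    replace (A n + (z - A n))%C with z in T by ring.
    rewrite Cmod_minus_sym in T.
    assert (0 <= L * (/2) ^ n) by (apply Rmult_le_pos; [exact HL|apply pow_le; lra]). lra. }
  pose proof (has_cderiv_C_derive f z Hf Hzr) as Hd. set (l := C_derive f z) in Hd.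
  apply Cmod_eq_0. apply Rle_antisym; [|apply Cmod_ge_0].
  apply le_epsilon. intros eps Heps. rewrite Rplus_0_l.
  (* The n-th triangle has integral at most 2 e times 5 L / 2^n times L / 2^n. The factor 4^n
     cancels the powers of 2 and leaves 10 L^2 e; the summand 1 covers L = 0. *)
  set (e := eps / (10 * L * L + 1)).
  assert (HLL : 0 <= L * L) by (apply Rmult_le_pos; assumption).
  assert (He : 0 < e) by (apply Rdiv_lt_0_compat; lra).
  destruct (Hd e He) as [d [Hd0 Hd1]].
  destruct (Small (Rmin d (1 - Cmod z))) as [n Hn]; [apply Rmin_glb_lt; lra|].
  set (D := 5 * L * (/ 2) ^ n) in *.
  assert (HDd : D < d) by (eapply Rlt_le_trans; [exact Hn|apply Rmin_l]).
  assert (HD1 : D < 1 - Cmod z) by (eapply Rlt_le_trans; [exact Hn|apply Rmin_r]).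
  destruct (Inv n) as [I1 [I2 [I3 [I4 [_ I6]]]]]. specialize (Hz n).
  assert (Pn : 0 <= L * (/ 2) ^ n) by (apply Rmult_le_pos; [exact HL|apply pow_le; lra]).
  unfold perim in I4.
  pose proof (Cmod_ge_0 (B n - A n)). pose proof (Cmod_ge_0 (G n - B n)).
  pose proof (Cmod_ge_0 (A n - G n)).
  assert (TT : Cmod (TInt f (A n) (B n) (G n)) <= 2 * e * D * perim (A n) (B n) (G n)).
  { apply TInt_local with (z := z) (l := l).
    - intros w Hw. apply Hd1. lra.
    - intros p q Hp Hq. apply Hc.
      + replace p with ((p - z) + z)%C by ring. eapply Rle_lt_trans; [apply Cmod_triangle|]. lra.
      + replace q with ((q - z) + z)%C by ring. eapply Rle_lt_trans; [apply Cmod_triangle|]. lra.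
    - lra.
    - unfold D. lra.
    - replace (B n - z)%C with ((B n - A n) + (A n - z))%C by ring.
      eapply Rle_trans; [apply Cmod_triangle|]. unfold D. lra.
    - replace (G n - z)%C with (- (A n - G n) + (A n - z))%C by ring.
      eapply Rle_trans; [apply Cmod_triangle|]. rewrite Cmod_opp. unfold D. lra. }
  unfold perim in TT. rewrite I4 in TT. unfold D in TT.
  eapply Rle_trans; [exact I6|].
  apply Rle_trans with (4 ^ n * (2 * e * (5 * L * (/ 2) ^ n) * (L * (/ 2) ^ n))).
  - apply Rmult_le_compat_l; [apply pow_le; lra|exact TT].
  - replace (4 ^ n * (2 * e * (5 * L * (/ 2) ^ n) * (L * (/ 2) ^ n)))
      with (10 * L * L * e * (4 ^ n * (/ 2) ^ n * (/ 2) ^ n)) by ring.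
    rewrite <- !Rpow_mult_distr. replace (4 * / 2 * / 2) with 1 by field. rewrite pow1, Rmult_1_r.
    apply Rle_trans with ((10 * L * L + 1) * e); [nra|].
    right. unfold e. field. lra.
Qed.

Lemma SInt_0_diff (f : C -> C) (z w : C) : analytic_on_disk f ->
  unit_disk z -> unit_disk w -> (SInt f 0 w - SInt f 0 z)%C = SInt f z w.
Proof.
  intros Hf Hz Hw. unfold unit_disk in *.
  pose proof (goursat_triangle f (Rmax (Cmod z) (Cmod w)) 0 z w Hf) as H.
  assert (Hm : Rmax (Cmod z) (Cmod w) < 1) by (now apply Rmax_lub_lt).
  specialize (H Hm).
  rewrite Cmod_0 in H.
  assert (T : TInt f 0 z w = 0).
  { apply H; [|apply Rmax_l|apply Rmax_r]. eapply Rle_trans; [apply (Cmod_ge_0 z)|apply Rmax_l]. }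
  unfold TInt in T. rewrite (SInt_swap f 0 w) in T.
  - replace (SInt f z w) with ((SInt f 0 z + SInt f z w + - SInt f 0 w) + SInt f 0 w - SInt f 0 z)%C by ring.
    rewrite T. ring.
  - intros t Ht. eapply path_cont_comp; [|apply path_cont_seg].
    apply has_cderiv_C_derive; [exact Hf|]. unfold unit_disk.
    apply Rle_lt_trans with (Cmod w); [|exact Hw].
    apply seg_Cmod0; auto; [rewrite Cmod_0; apply Cmod_ge_0|lra].
Qed.

(** By Goursat the increment of [SInt f 0] is the integral over the segment from z to w, so
    continuity of f at z alone gives the derivative. *)
Lemma analytic_has_primitive (f : C -> C) : analytic_on_disk f ->
  forall z, unit_disk z -> has_cderiv (SInt f 0) z (f z).
Proof.
  intros Hf z Hz eps Heps.
  destruct (has_cderiv_continuous f z _ (has_cderiv_C_derive f z Hf Hz) (eps / 2)) as [d [Hd H]]; [lra|].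
  exists (Rmin d (1 - Cmod z)). unfold unit_disk in Hz.
  split; [apply Rmin_glb_lt; lra|]. intros w Hw.
  assert (H1 : Cmod (w - z) < d) by (eapply Rlt_le_trans; [exact Hw|apply Rmin_l]).
  assert (H2 : Cmod (w - z) < 1 - Cmod z) by (eapply Rlt_le_trans; [exact Hw|apply Rmin_r]).
  assert (Hw1 : unit_disk w).
  { unfold unit_disk. replace w with ((w - z) + z)%C by ring.
    eapply Rle_lt_trans; [apply Cmod_triangle|]. lra. }
  rewrite (SInt_0_diff f z w Hf Hz Hw1).
  assert (Hc : cont_on (fun t => f (seg z w t)) 0 1).
  { intros t Ht. eapply path_cont_comp; [|apply path_cont_seg].
    apply has_cderiv_C_derive; [exact Hf|]. unfold unit_disk in *.
    eapply Rle_lt_trans; [apply (seg_Cmod0 z w t (Rmax (Cmod z) (Cmod w)) Ht)|].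
    - apply Rmax_l. - apply Rmax_r. - now apply Rmax_lub_lt. }
  assert (Hk : cont_on (fun t : R => f z) 0 1) by (intros t _; apply path_cont_const).
  replace (f z * (w - z))%C with (SInt (fun _ => f z) z w).
  2:{ unfold SInt. rewrite CInt_const. rewrite Rminus_0_r. ring. }
  rewrite <- (SInt_minus f (fun _ => f z)); auto.
  eapply Rle_trans; [apply (SInt_bound (fun y => f y - f z)%C) with (M := eps / 2)|].
  - intros t Ht. apply path_cont_plus; [apply Hc, Ht|apply path_cont_const].
  - intros t Ht. left. apply H. eapply Rle_lt_trans; [|exact H1].
    apply seg_Cmod; auto; [|lra].
    replace (z - z)%C with (RtoC 0) by ring. rewrite Cmod_0. apply Cmod_ge_0.
  - right. field.
Qed.

(** * Cauchy's integral formula *)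

Definition cis (t : R) : C := (cos t, sin t).

Lemma Cmod_cis (t : R) : Cmod (cis t) = 1.
Proof.
  unfold Cmod, cis; simpl. rewrite !Rmult_1_r.
  pose proof (sin2_cos2 t) as H. unfold Rsqr in H.
  replace (cos t * cos t + sin t * sin t) with 1 by lra. apply sqrt_1.
Qed.

Lemma path_deriv_cis (t : R) : path_deriv cis t (Ci * cis t).
Proof.
  split; simpl.
  - auto_derive; [trivial|]. ring.
  - auto_derive; [trivial|]. ring.
Qed.

Lemma Ci_sq : (Ci * Ci = - RtoC 1)%C.
Proof. apply C_ext; simpl; ring. Qed.

Lemma cis_0 : cis 0 = 1.
Proof. unfold cis. now rewrite cos_0, sin_0. Qed.

Lemma cis_2PI : cis (2 * PI) = 1.
Proof. unfold cis. now rewrite cos_2PI, sin_2PI. Qed.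

Definition circ (r t : R) : C := (RtoC r * cis t)%C.

Lemma Cmod_circ (r t : R) : 0 <= r -> Cmod (circ r t) = r.
Proof.
  intros Hr. unfold circ. rewrite Cmod_mult, Cmod_cis, Cmod_R, Rabs_pos_eq; lra.
Qed.

Lemma path_deriv_circ (r t : R) : path_deriv (circ r) t (Ci * circ r t).
Proof.
  unfold circ. eapply path_deriv_eq.
  2:{ apply path_deriv_mult; [apply path_deriv_const|apply path_deriv_cis]. }
  cbv beta. ring.
Qed.

Lemma path_cont_circ (r t : R) : path_cont (circ r) t.
Proof. eapply path_deriv_cont, path_deriv_circ. Qed.

Lemma circ_2PI (r : R) : circ r (2 * PI) = circ r 0.
Proof. unfold circ. now rewrite cis_2PI, cis_0. Qed.

Lemma circ_minus_lower (r t : R) (z : C) : 0 <= r -> r - Cmod z <= Cmod (circ r t - z).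
Proof.
  intros Hr. pose proof (Cmod_triangle (circ r t - z) z) as T.
  replace (circ r t - z + z)%C with (circ r t) in T by ring.
  rewrite Cmod_circ in T by assumption. lra.
Qed.

Lemma circ_minus_neq0 (r t : R) (z : C) : Cmod z < r -> (circ r t - z)%C <> 0.
Proof.
  intros Hz E. pose proof (Cmod_ge_0 z).
  pose proof (circ_minus_lower r t z ltac:(lra)) as H1. rewrite E, Cmod_0 in H1. lra.
Qed.

Lemma path_cont_kernel (r t : R) (z : C) (n : nat) : Cmod z < r ->
  path_cont (fun s => (/ (circ r s - z)) ^ n)%C t.
Proof.
  intros Hz.
  assert (H : path_cont (fun s => / (circ r s - z))%C t).
  { eapply (path_cont_comp (fun y => / y)%C (fun s => circ r s - z)%C).
    - apply has_cderiv_inv_id. now apply circ_minus_neq0.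
    - apply (path_cont_plus (circ r) (fun _ => - z)%C); [apply path_cont_circ|apply path_cont_const]. }
  induction n; simpl; [apply path_cont_const|]. now apply path_cont_mult.
Qed.

Definition cmean (f : R -> C) : C := (RtoC (/ (2 * PI)) * CInt f 0 (2 * PI))%C.

Definition cont2PI (f : R -> C) : Prop := cont_on f 0 (2 * PI).

Lemma PI2_pos : 0 < 2 * PI.
Proof. pose proof PI_RGT_0. lra. Qed.

Lemma cmean_ext (f g : R -> C) : (forall t, f t = g t) -> cmean f = cmean g.
Proof. intros E. unfold cmean. f_equal. apply CInt_ext; auto. pose proof PI2_pos; lra. Qed.

Lemma cmean_plus (f g : R -> C) : cont2PI f -> cont2PI g ->
  cmean (fun t => f t + g t)%C = (cmean f + cmean g)%C.
Proof.
  intros Hf Hg. unfold cmean. pose proof PI2_pos. rewrite CInt_plus; auto; [ring|lra].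
Qed.

Lemma cmean_minus (f g : R -> C) : cont2PI f -> cont2PI g ->
  cmean (fun t => f t - g t)%C = (cmean f - cmean g)%C.
Proof.
  intros Hf Hg. unfold cmean. pose proof PI2_pos. rewrite CInt_minus; auto; [ring|lra].
Qed.

Lemma cmean_scal (c : C) (f : R -> C) : cont2PI f ->
  cmean (fun t => c * f t)%C = (c * cmean f)%C.
Proof.
  intros Hf. unfold cmean. pose proof PI2_pos. rewrite CInt_scal; auto; [ring|lra].
Qed.

Lemma cmean_const (c : C) : cmean (fun _ => c) = c.
Proof.
  unfold cmean. rewrite CInt_const. pose proof PI2_pos.
  rewrite Rminus_0_r, RtoC_inv by lra. field.
  intro E. apply (f_equal Re) in E. simpl in E. lra.
Qed.

Lemma cmean_bound (f : R -> C) (M : R) : cont2PI f ->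
  (forall t, 0 <= t <= 2 * PI -> Cmod (f t) <= M) -> Cmod (cmean f) <= 2 * M.
Proof.
  intros Hf HM. unfold cmean. pose proof PI2_pos.
  rewrite Cmod_mult, Cmod_R, Rabs_pos_eq by (left; apply Rinv_0_lt_compat; lra).
  apply Rle_trans with (/ (2 * PI) * (2 * (2 * PI - 0) * M)).
  - apply Rmult_le_compat_l; [left; apply Rinv_0_lt_compat; lra|].
    apply CInt_bound; auto; lra.
  - right. field. apply PI_neq0.
Qed.

Lemma cmean_deriv (F f : R -> C) : (forall t, path_deriv F t (f t)) -> cont2PI f ->
  F (2 * PI) = F 0 -> cmean f = 0.
Proof.
  intros HF Hf E. unfold cmean. rewrite (CInt_deriv F); auto.
  - rewrite E. ring.
  - pose proof PI2_pos; lra.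
Qed.

(** Meant for u = 1 / (zeta - y), v = 1 / (zeta - z) and h = y - z, which satisfy u - v = u v h. It
    is the first-order expansion of the kernel power in z, with a constant depending only on n and
    the bound M, hence uniform in zeta on the circle. *)
Lemma inv_pow_expansion (n : nat) (M : R) : 0 <= M -> exists c, 0 <= c /\
  forall u v h : C, Cmod u <= M -> Cmod v <= M -> (u - v = u * v * h)%C ->
    Cmod (u ^ n - v ^ n - RtoC (INR n) * v ^ S n * h) <= c * (Cmod h * Cmod h).
Proof.
  intros HM. induction n as [|n [c [Hc IH]]].
  - exists 0. split; [lra|]. intros u v h _ _ _.
    replace (u ^ 0 - v ^ 0 - RtoC (INR 0) * v ^ 1 * h)%C with (RtoC 0) by (simpl; ring).
    rewrite Cmod_0. lra.
  - exists (M * c + INR (S n) * M ^ S n * M * M). split.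
    { assert (0 <= M ^ S n) by now apply pow_le. pose proof (pos_INR (S n)).
      apply Rplus_le_le_0_compat; [nra|]. repeat apply Rmult_le_pos; auto using pow_le. }
    intros u v h Hu Hv E. specialize (IH u v h Hu Hv E).
    assert (EE : (u ^ S n - v ^ S n - RtoC (INR (S n)) * v ^ S (S n) * h
      = u * (u ^ n - v ^ n - RtoC (INR n) * v ^ S n * h)
        + RtoC (INR (S n)) * v ^ S n * h * (u * v * h))%C).
    { rewrite S_INR, RtoC_plus.
      (* The identity holds only modulo u - v = u v h; the last summand is the explicit multiple of
         this relation that makes it an identity for [ring]. *)
      replace (u ^ S n - v ^ S n - (RtoC (INR n) + 1) * v ^ S (S n) * h)%C with
        (u * (u ^ n - v ^ n - RtoC (INR n) * v ^ S n * h)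
         + (RtoC (INR n) + 1) * v ^ S n * h * (u * v * h)
         + v ^ n * (1 + (RtoC (INR n) + 1) * v * h) * (u - v - u * v * h))%C by (simpl; ring).
      rewrite E. ring. }
    rewrite EE. eapply Rle_trans; [apply Cmod_triangle|].
    rewrite !Cmod_mult, Cmod_R, Cmod_pow, (Rabs_pos_eq (INR (S n))) by apply pos_INR.
    pose proof (Cmod_ge_0 u). pose proof (Cmod_ge_0 v). pose proof (Cmod_ge_0 h).
    pose proof (pos_INR (S n)).
    rewrite Rmult_plus_distr_r. apply Rplus_le_compat.
    + rewrite Rmult_assoc. apply Rmult_le_compat; auto. apply Cmod_ge_0.
    + assert (P : Cmod v ^ S n <= M ^ S n) by (apply pow_incr; lra).
      assert (P0 : 0 <= Cmod v ^ S n) by now apply pow_le.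
      replace (INR (S n) * Cmod v ^ S n * Cmod h * (Cmod u * Cmod v * Cmod h))
        with (INR (S n) * (Cmod v ^ S n * Cmod u * Cmod v) * (Cmod h * Cmod h)) by ring.
      apply Rmult_le_compat_r; [nra|].
      replace (INR (S n) * M ^ S n * M * M) with (INR (S n) * (M ^ S n * M * M)) by ring.
      apply Rmult_le_compat_l; auto.
      apply Rmult_le_compat; [now apply Rmult_le_pos|assumption| |assumption].
      now apply Rmult_le_compat.
Qed.

(** With zeta = circ r t, the form d zeta / (2 pi i) becomes zeta dt / (2 pi). Cauchy's integral is
    therefore a plain mean, and the factor zeta is put into the density [g]. Differentiation in z
    only raises n. *)
Definition cauchy_int (r : R) (g : R -> C) (n : nat) (z : C) : C :=
  cmean (fun t => g t * (/ (circ r t - z)) ^ n)%C.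

Lemma cauchy_int_cont (r : R) (g : R -> C) (n : nat) (z : C) : Cmod z < r -> cont2PI g ->
  cont2PI (fun t => g t * (/ (circ r t - z)) ^ n)%C.
Proof.
  intros Hz Hg t Ht. apply path_cont_mult; [now apply Hg|now apply path_cont_kernel].
Qed.

Lemma cont_on_bounded (f : R -> C) (a b : R) : a <= b -> cont_on f a b ->
  exists M, forall t, a <= t <= b -> Cmod (f t) <= M.
Proof.
  intros Hab Hf.
  destruct (@bounded_continuity R_AbsRing R_NormedModule (fun t => Re (f t)) a b) as [M1 H1].
  { intros t Ht. apply (Hf t Ht). }
  destruct (@bounded_continuity R_AbsRing R_NormedModule (fun t => Im (f t)) a b) as [M2 H2].
  { intros t Ht. apply (Hf t Ht). }
  exists (M1 + M2). intros t Ht. eapply Rle_trans; [apply Cmod_le_Re_Im|].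
  apply Rplus_le_compat; left; [exact (H1 t Ht)|exact (H2 t Ht)].
Qed.

Lemma has_cderiv_cauchy_int (r : R) (g : R -> C) (n : nat) (z : C) :
  Cmod z < r -> cont2PI g ->
  has_cderiv (cauchy_int r g n) z (RtoC (INR n) * cauchy_int r g (S n) z).
Proof.
  intros Hz Hg eps Heps. pose proof PI2_pos as HPI.
  destruct (cont_on_bounded g 0 (2 * PI) ltac:(lra) Hg) as [G HG].
  (* For |y - z| < dd both y and z keep distance at least dd from the circle, so both kernels are
     bounded by 1 / dd and one expansion constant c serves all t. The error is then at most 2 G c |y
     - z|^2, where the 2 comes from [cmean_bound]. *)
  set (dd := (r - Cmod z) / 2). assert (Hdd : 0 < dd) by (unfold dd; lra).
  pose proof (Cmod_ge_0 z) as Hz0.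
  destruct (inv_pow_expansion n (/ dd)) as [c [Hc E]].
  { left; now apply Rinv_0_lt_compat. }
  assert (HG0 : 0 <= G) by (eapply Rle_trans; [apply Cmod_ge_0|apply (HG 0); lra]).
  assert (HGc : 0 <= G * c) by now apply Rmult_le_pos.
  exists (Rmin dd (eps / (2 * (G * c) + 1))). split.
  { apply Rmin_glb_lt; [exact Hdd|]. apply Rdiv_lt_0_compat; lra. }
  intros y Hy.
  assert (Hy1 : Cmod (y - z) < dd) by (eapply Rlt_le_trans; [exact Hy|apply Rmin_l]).
  assert (Hy2 : Cmod (y - z) < eps / (2 * (G * c) + 1)) by (eapply Rlt_le_trans; [exact Hy|apply Rmin_r]).
  assert (Hyr : Cmod y < r - dd).
  { replace y with ((y - z) + z)%C by ring. eapply Rle_lt_trans; [apply Cmod_triangle|]. unfold dd in *. lra. }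
  assert (Hyr' : Cmod y < r) by lra.
  unfold cauchy_int.
  assert (Cn : cont2PI (fun t => g t * (/ (circ r t - z)) ^ n)%C) by now apply cauchy_int_cont.
  assert (Cy : cont2PI (fun t => g t * (/ (circ r t - y)) ^ n)%C) by now apply cauchy_int_cont.
  assert (CS : cont2PI (fun t => g t * (/ (circ r t - z)) ^ S n)%C) by now apply cauchy_int_cont.
  replace (RtoC (INR n) * cmean (fun t => g t * (/ (circ r t - z)) ^ S n) * (y - z))%C
    with (RtoC (INR n) * (y - z) * cmean (fun t => g t * (/ (circ r t - z)) ^ S n))%C by ring.
  rewrite <- cmean_scal by exact CS. rewrite <- cmean_minus by assumption.
  rewrite <- cmean_minus.
  2:{ intros t Ht. apply (path_cont_ext (fun t => g t * (/ (circ r t - y)) ^ n + (- RtoC 1) * (g t * (/ (circ r t - z)) ^ n))%C).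
      - intros; ring.
      - apply path_cont_plus; [now apply Cy|]. apply path_cont_mult; [apply path_cont_const|now apply Cn]. }
  2:{ intros t Ht. apply path_cont_mult; [apply path_cont_const|now apply CS]. }
  apply Rle_trans with (2 * (G * (c * (Cmod (y - z) * Cmod (y - z))))).
  - apply cmean_bound.
    + intros t Ht. apply (path_cont_ext (fun t => g t * (/ (circ r t - y)) ^ n + ((- RtoC 1) * (g t * (/ (circ r t - z)) ^ n)
         + (- RtoC 1) * (RtoC (INR n) * (y - z) * (g t * (/ (circ r t - z)) ^ S n))))%C).
      * intros; ring.
      * apply path_cont_plus; [now apply Cy|]. apply path_cont_plus.
        -- apply path_cont_mult; [apply path_cont_const|now apply Cn].
        -- apply path_cont_mult; [apply path_cont_const|]. apply path_cont_mult; [apply path_cont_const|now apply CS].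
    + intros t Ht.
      replace (g t * (/ (circ r t - y)) ^ n - g t * (/ (circ r t - z)) ^ n -
         RtoC (INR n) * (y - z) * (g t * (/ (circ r t - z)) ^ S n))%C
       with (g t * ((/ (circ r t - y)) ^ n - (/ (circ r t - z)) ^ n -
          RtoC (INR n) * (/ (circ r t - z)) ^ S n * (y - z)))%C by ring.
      rewrite Cmod_mult. apply Rmult_le_compat; try apply Cmod_ge_0; [now apply HG|].
      pose proof (circ_minus_neq0 r t y Hyr') as N1. pose proof (circ_minus_neq0 r t z Hz) as N2.
      apply E.
      * rewrite Cmod_inv by exact N1. apply Rinv_le_contravar; [exact Hdd|].
        pose proof (circ_minus_lower r t y ltac:(lra)). lra.
      * rewrite Cmod_inv by exact N2. apply Rinv_le_contravar; [exact Hdd|].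
        pose proof (circ_minus_lower r t z ltac:(lra)). unfold dd. lra.
      * field. auto.
  - pose proof (Cmod_ge_0 (y - z)).
    apply (Rmult_lt_compat_r (2 * (G * c) + 1)) in Hy2; [|lra].
    unfold Rdiv in Hy2. rewrite Rmult_assoc, Rinv_l, Rmult_1_r in Hy2 by lra.
    replace (2 * (G * (c * (Cmod (y - z) * Cmod (y - z))))) with ((Cmod (y - z) * (2 * (G * c))) * Cmod (y - z)) by ring.
    apply Rmult_le_compat_r; [assumption|]. nra.
Qed.

Lemma zero_deriv_path_constant (g : R -> C) (a b : R) : a < b ->
  (forall t, a <= t <= b -> path_deriv g t 0) -> g a = g b.
Proof.
  intros Hab H. apply C_ext.
  - apply (eq_is_derive (fun t => Re (g t)) a b); [|exact Hab]. intros t Ht. apply (H t Ht).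
  - apply (eq_is_derive (fun t => Im (g t)) a b); [|exact Hab]. intros t Ht. apply (H t Ht).
Qed.

(** As a function of the centre a, this mean has as derivative the mean of zeta / (zeta - a)^2. That
    integrand is the t-derivative of the periodic function i / (zeta - a), so the mean is constant
    along the segment from 0 to a, and at 0 the integrand is 1. *)
Lemma cmean_cauchy_kernel (r : R) (a : C) : Cmod a < r ->
  cmean (fun t => circ r t * (/ (circ r t - a)) ^ 1)%C = 1.
Proof.
  intros Ha. pose proof (Cmod_ge_0 a) as Ha0.
  assert (Hr : 0 < r) by lra.
  assert (Cc : cont2PI (circ r)) by (intros t _; apply path_cont_circ).
  assert (D : forall z, Cmod z < r -> has_cderiv (cauchy_int r (circ r) 1) z 0).
  { intros z Hz. eapply has_cderiv_eq.
    2:{ apply has_cderiv_cauchy_int; auto. }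
    replace (cauchy_int r (circ r) 2 z) with (RtoC 0); [ring|]. symmetry.
    unfold cauchy_int.
    apply cmean_deriv with (F := fun t => (Ci * / (circ r t - z))%C).
    - intros t. eapply path_deriv_eq.
      2:{ apply path_deriv_mult; [apply path_deriv_const|].
          apply (path_deriv_comp (fun y => / y)%C (fun t => circ r t - z)%C).
          - apply has_cderiv_inv_id. now apply circ_minus_neq0.
          - apply path_deriv_plus; [apply path_deriv_circ|apply path_deriv_const]. }
      cbv beta.
      transitivity (- (Ci * Ci) * (/ (circ r t - z) * / (circ r t - z)) * circ r t)%C; [ring|].
      rewrite Ci_sq. ring.
    - now apply cauchy_int_cont.
    - now rewrite circ_2PI. }
  change (cauchy_int r (circ r) 1 a = 1).
  transitivity (cauchy_int r (circ r) 1 (seg 0 a 1)).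
  { f_equal. unfold seg. ring. }
  rewrite <- (zero_deriv_path_constant (fun t => cauchy_int r (circ r) 1 (seg 0 a t)) 0 1); [|lra|].
  - unfold cauchy_int. rewrite <- (cmean_const 1). apply cmean_ext. intro t.
    assert (N := circ_minus_neq0 r t 0 ltac:(rewrite Cmod_0; lra)).
    replace (seg 0 a 0) with (RtoC 0) by (unfold seg; ring).
    simpl. replace (circ r t - 0)%C with (circ r t) in * by ring. field. exact N.
  - intros t Ht. eapply path_deriv_eq; [|apply path_deriv_comp; [apply D|apply path_deriv_seg]].
    + ring.
    + eapply Rle_lt_trans; [apply (seg_Cmod0 0 a t (Cmod a) Ht)|]; [rewrite Cmod_0; lra|lra|lra].
Qed.

(** * Joint continuity and differentiation under the integral sign *)

Definition cont2 (h : R -> R -> C) (x t : R) : Prop :=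
  continuity_2d_pt (fun u v => Re (h u v)) x t /\
  continuity_2d_pt (fun u v => Im (h u v)) x t.

Lemma cont2_eps (h : R -> R -> C) (x t : R) :
  cont2 h x t <->
  (forall eps, 0 < eps -> exists d, 0 < d /\ forall u v, Rabs (u - x) < d -> Rabs (v - t) < d ->
     Cmod (h u v - h x t) < eps).
Proof.
  split.
  - intros [H1 H2] eps Heps. assert (He : 0 < eps / 2) by lra.
    destruct (H1 (mkposreal _ He)) as [d1 K1]. destruct (H2 (mkposreal _ He)) as [d2 K2].
    exists (Rmin d1 d2). split; [apply Rmin_glb_lt; apply cond_pos|]. intros u v Hu Hv.
    eapply Rle_lt_trans; [apply Cmod_le_Re_Im|].
    assert (A1 : Rmin d1 d2 <= d1) by apply Rmin_l.
    assert (A2 : Rmin d1 d2 <= d2) by apply Rmin_r.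
    assert (B1 : Rabs (Re (h u v) - Re (h x t)) < eps / 2) by (apply K1; lra).
    assert (B2 : Rabs (Im (h u v) - Im (h x t)) < eps / 2) by (apply K2; lra).
    replace (Re (h u v - h x t)) with (Re (h u v) - Re (h x t)) by reflexivity.
    replace (Im (h u v - h x t)) with (Im (h u v) - Im (h x t)) by reflexivity.
    lra.
  - intros H. split; intros eps; destruct (H eps (cond_pos eps)) as [d [Hd K]];
    exists (mkposreal d Hd); intros u v Hu Hv; (eapply Rle_lt_trans; [|apply (K u v Hu Hv)]).
    + apply (re_le_Cmod (h u v - h x t)).
    + apply (Im_le_Cmod (h u v - h x t)).
Qed.

Lemma cont2_comp (f : C -> C) (h : R -> R -> C) (x t : R) (l : C) :
  has_cderiv f (h x t) l -> cont2 h x t -> cont2 (fun u v => f (h u v)) x t.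
Proof.
  intros Hf Hh. apply cont2_eps. intros eps Heps.
  destruct (has_cderiv_continuous _ _ _ Hf eps Heps) as [e [He K]].
  destruct (proj1 (cont2_eps h x t) Hh e He) as [d [Hd L]].
  exists d. split; [exact Hd|]. intros u v Hu Hv. apply K. now apply L.
Qed.

Lemma cont2_mult (f g : R -> R -> C) (x t : R) :
  cont2 f x t -> cont2 g x t -> cont2 (fun u v => f u v * g u v)%C x t.
Proof.
  intros [F1 F2] [G1 G2]. split.
  - apply (continuity_2d_pt_minus (fun u v => Re (f u v) * Re (g u v)) (fun u v => Im (f u v) * Im (g u v)));
    now apply continuity_2d_pt_mult.
  - apply (continuity_2d_pt_plus (fun u v => Re (f u v) * Im (g u v)) (fun u v => Im (f u v) * Re (g u v)));
    now apply continuity_2d_pt_mult.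
Qed.

Lemma cont2_plus (f g : R -> R -> C) (x t : R) :
  cont2 f x t -> cont2 g x t -> cont2 (fun u v => f u v + g u v)%C x t.
Proof.
  intros [F1 F2] [G1 G2]. split.
  - now apply (continuity_2d_pt_plus (fun u v => Re (f u v)) (fun u v => Re (g u v))).
  - now apply (continuity_2d_pt_plus (fun u v => Im (f u v)) (fun u v => Im (g u v))).
Qed.

Lemma cont2_snd (g : R -> C) (x t : R) : path_cont g t -> cont2 (fun _ v => g v) x t.
Proof.
  intros H. apply cont2_eps. intros eps Heps.
  destruct (proj1 (path_cont_eps g t) H eps Heps) as [d [Hd K]].
  exists d. split; auto.
Qed.

Lemma cont2_fst (g : R -> C) (x t : R) : path_cont g x -> cont2 (fun u _ => g u) x t.
Proof.
  intros H. apply cont2_eps. intros eps Heps.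
  destruct (proj1 (path_cont_eps g x) H eps Heps) as [d [Hd K]].
  exists d. split; auto.
Qed.

Lemma CInt_param_deriv (k dk : R -> R -> C) (a b x eta : R) : a <= b -> 0 < eta ->
  (forall u t, Rabs (u - x) < eta -> path_deriv (fun s => k s t) u (dk u t)) ->
  (forall u t, Rabs (u - x) < eta -> path_cont (k u) t) ->
  (forall t, cont2 dk x t) ->
  path_deriv (fun s => CInt (k s) a b) x (CInt (dk x) a b).
Proof.
  intros Hab Heta Hd Hc Hc2.
  assert (G : forall (p : C -> R),
    (forall u t, Rabs (u - x) < eta -> is_derive (fun s => p (k s t)) u (p (dk u t))) ->
    (forall u, Rabs (u - x) < eta -> ex_RInt (fun t => p (k u t)) a b) ->
    (forall t, a <= t <= b -> continuity_2d_pt (fun u v => p (dk u v)) x t) ->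
    is_derive (fun s => RInt (fun t => p (k s t)) a b) x (RInt (fun t => p (dk x t)) a b)).
  { intros p P1 P2 P3.
    assert (Hx : Rabs (x - x) < eta) by (rewrite Rminus_diag, Rabs_R0; lra).
    replace (RInt (fun t => p (dk x t)) a b) with (RInt (fun t => Derive (fun u => p (k u t)) x) a b).
    2:{ apply RInt_ext. intros t _. apply is_derive_unique. now apply P1. }
    apply is_derive_RInt_param with (f := fun s t => p (k s t)).
    - exists (mkposreal _ Heta). intros u Hu t _. eexists. apply P1. exact Hu.
    - rewrite Rmin_left, Rmax_right by assumption. intros t Ht.
      eapply continuity_2d_pt_ext_loc; [|apply (P3 t Ht)].
      exists (mkposreal _ Heta). intros u v Hu _. symmetry. apply is_derive_unique. now apply P1.
    - exists (mkposreal _ Heta). intros u Hu. apply P2. exact Hu. }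
  split.
  - apply (G Re).
    + intros u t Hu. apply (Hd u t Hu).
    + intros u Hu. apply (cont_on_ex_RInt_Re (k u)); [exact Hab|]. intros t Ht. now apply Hc.
    + intros t Ht. apply (Hc2 t).
  - apply (G Im).
    + intros u t Hu. apply (Hd u t Hu).
    + intros u Hu. apply (cont_on_ex_RInt_Im (k u)); [exact Hab|]. intros t Ht. now apply Hc.
    + intros t Ht. apply (Hc2 t).
Qed.

(** The parameter u may leave [0, 1] by [eta], because the two-sided derivatives at the ends 0 and 1
    of the homotopy need a full neighbourhood. There |1 - u| + |u| <= 1 + 2 eta. *)
Lemma homotopy_in_disk (a z : C) (u x eta rho : R) :
  0 <= x <= 1 -> Rabs (u - x) < eta -> Cmod a <= rho -> Cmod z <= rho ->
  (1 + 2 * eta) * rho < 1 -> unit_disk (a + RtoC u * (z - a))%C.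
Proof.
  intros Hx Hu Ha Hz Hr. unfold unit_disk.
  replace (a + RtoC u * (z - a))%C with (RtoC (1 - u) * a + RtoC u * z)%C by (rewrite RtoC_minus; ring).
  eapply Rle_lt_trans; [apply Cmod_triangle|]. rewrite !Cmod_mult, !Cmod_R.
  pose proof (Cmod_ge_0 a). pose proof (Rabs_pos u). pose proof (Rabs_pos (1 - u)).
  assert (Rabs (1 - u) + Rabs u <= 1 + 2 * eta).
  { apply Rabs_def2 in Hu. unfold Rabs. destruct (Rcase_abs (1 - u)), (Rcase_abs u); lra. }
  apply Rle_lt_trans with ((Rabs (1 - u) + Rabs u) * rho); [nra|]. nra.
Qed.

(* Along the homotopy [a + s (circ r t - a)] from the constant loop [a] to the circle, the
   [s]-derivative of the integral is an exact [t]-derivative divided by [s]. *)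
Lemma cauchy_formula_C1 (F f df : C -> C) (r : R) (a : C) :
  (forall z, unit_disk z -> has_cderiv F z (f z)) ->
  (forall z, unit_disk z -> has_cderiv f z (df z)) ->
  r < 1 -> Cmod a < r ->
  F a = cauchy_int r (fun t => F (circ r t) * circ r t)%C 1 a.
Proof.
  intros HF Hf Hr Ha. pose proof (Cmod_ge_0 a) as Ha0.
  pose proof PI2_pos as HPI.
  set (eta := (1 - r) / 4). assert (Heta : 0 < eta) by (unfold eta; lra).
  assert (Hrho : (1 + 2 * eta) * r < 1) by (unfold eta; nra).
  set (P := fun u t => (a + RtoC u * (circ r t - a))%C).
  (* This weight satisfies (circ r t - a) w t = circ r t, so the derivative [dk] of the weighted
     integrand [k] in the homotopy parameter contains no kernel any more. At parameter 0 the mean of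
     [k] is F a, at parameter 1 it is the Cauchy integral. *)
  set (w := fun t => (circ r t * (/ (circ r t - a)) ^ 1)%C).
  assert (HP : forall x u t, 0 <= x <= 1 -> Rabs (u - x) < eta -> unit_disk (P u t)).
  { intros x u t Hx Hu. apply (homotopy_in_disk a (circ r t) u x eta r); auto; [lra|].
    rewrite Cmod_circ; lra. }
  assert (HP' : forall x t, 0 <= x <= 1 -> unit_disk (P x t)).
  { intros x t Hx. apply (HP x x t Hx). now rewrite Rminus_diag, Rabs_R0. }
  assert (PD : forall u t, path_deriv (fun t => P u t) t (RtoC u * (Ci * circ r t))).
  { intros u t. unfold P. eapply path_deriv_eq.
    2:{ apply path_deriv_plus; [apply path_deriv_const|].
        apply path_deriv_mult; [apply path_deriv_const|].
        apply (path_deriv_plus (circ r) (fun _ => - a)%C); [apply path_deriv_circ|apply path_deriv_const]. }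
    cbv beta. ring. }
  assert (PU : forall u t, path_deriv (fun u => P u t) u (circ r t - a)).
  { intros u t. unfold P. eapply path_deriv_eq.
    2:{ apply path_deriv_plus; [apply path_deriv_const|].
        apply path_deriv_mult; [apply path_deriv_RtoC|apply path_deriv_const]. }
    cbv beta. ring. }
  assert (Wc : forall t, path_cont w t).
  { intros t. apply path_cont_mult; [apply path_cont_circ|now apply path_cont_kernel]. }
  assert (Hw : forall t, ((circ r t - a) * w t = circ r t)%C).
  { intros t. unfold w. simpl. pose proof (circ_minus_neq0 r t a Ha). field. assumption. }
  set (k := fun u t => (F (P u t) * w t)%C).
  set (dk := fun u t => (f (P u t) * circ r t)%C).
  assert (Z : forall x, 0 <= x <= 1 -> CInt (dk x) 0 (2 * PI) = 0).
  { intros x Hx.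
    assert (Cdk : cont_on (dk x) 0 (2 * PI)).
    { intros t _. apply path_cont_mult; [|apply path_cont_circ].
      eapply path_cont_comp; [apply Hf, HP'; exact Hx|]. eapply path_deriv_cont, PD. }
    (* At x = 0 division by x is impossible, but there the loop is the constant a and [dk] is the
       multiple f a of [circ r], whose integral over a period vanishes. *)
    destruct (Req_dec x 0) as [->|Hx0].
    - rewrite (CInt_deriv (fun t => f a * (- Ci * circ r t))%C).
      + rewrite circ_2PI. ring.
      + lra.
      + intros t _. unfold dk, P. replace (a + 0 * (circ r t - a))%C with a by ring.
        eapply path_deriv_eq.
        2:{ apply path_deriv_mult; [apply path_deriv_const|].
            apply path_deriv_mult; [apply path_deriv_const|apply path_deriv_circ]. }
        cbv beta. transitivity (f a * (- (Ci * Ci) * circ r t))%C; [ring|]. rewrite Ci_sq. ring.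
      + exact Cdk.
    - assert (E : (RtoC x * Ci * CInt (dk x) 0 (2 * PI) = 0)%C).
      { rewrite <- CInt_scal; [|lra|exact Cdk].
        rewrite (CInt_deriv (fun t => F (P x t))).
        - unfold P. rewrite circ_2PI. ring.
        - lra.
        - intros t _. eapply path_deriv_eq; [|apply path_deriv_comp; [apply HF, HP'; exact Hx|apply PD]].
          unfold dk. ring.
        - intros t Ht. apply path_cont_mult; [apply path_cont_const|now apply Cdk]. }
      assert (N : (RtoC x * Ci)%C <> 0).
      { apply Cmult_neq_0.
        - intro E1. apply Hx0. now apply RtoC_inj.
        - intro E1. apply (f_equal Im) in E1. simpl in E1. lra. }
      rewrite <- (Cmult_1_l (CInt _ _ _)). rewrite <- (Cinv_l _ N).
      rewrite <- Cmult_assoc, E. ring. }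
  assert (Const : CInt (k 0) 0 (2 * PI) = CInt (k 1) 0 (2 * PI)).
  { apply (zero_deriv_path_constant (fun s => CInt (k s) 0 (2 * PI)) 0 1); [lra|].
    intros x Hx. rewrite <- (Z x Hx).
    apply CInt_param_deriv with (eta := eta); [lra|exact Heta| | |].
    - intros u t Hu. unfold k, dk. eapply path_deriv_eq.
      2:{ apply path_deriv_mult; [|apply path_deriv_const].
          eapply path_deriv_comp; [apply HF, (HP x); auto|apply PU]. }
      cbv beta. rewrite <- (Hw t) at 2. ring.
    - intros u t Hu. unfold k. apply path_cont_mult; [|apply Wc].
      eapply path_cont_comp; [apply HF, (HP x); auto|]. eapply path_deriv_cont, PD.
    - intros t. unfold dk. apply cont2_mult; [|apply cont2_snd, path_cont_circ].
      eapply cont2_comp; [apply Hf, HP'; exact Hx|]. unfold P.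
      apply cont2_plus; [apply cont2_snd, path_cont_const|].
      apply cont2_mult; [apply cont2_fst; eapply path_deriv_cont, path_deriv_RtoC|].
      apply cont2_snd. apply (path_cont_plus (circ r) (fun _ => - a)%C);
        [apply path_cont_circ|apply path_cont_const]. }
  assert (E0 : cmean (k 0) = F a).
  { transitivity (cmean (fun t => F a * w t)%C).
    - apply cmean_ext. intros t. unfold k, P. f_equal. f_equal. ring.
    - rewrite cmean_scal by (intros t _; apply Wc). unfold w.
      rewrite cmean_cauchy_kernel by exact Ha. ring. }
  assert (E1 : cmean (k 1) = cauchy_int r (fun t => F (circ r t) * circ r t)%C 1 a).
  { apply cmean_ext. intros t. unfold k, P, w.
    replace (a + 1 * (circ r t - a))%C with (circ r t) by ring. ring. }
  rewrite <- E0, <- E1. unfold cmean. now rewrite Const.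
Qed.

(** * Analyticity of derivatives and Cauchy's formula for analytic functions *)

Lemma cont2PI_circle_density (f : C -> C) (r : R) : analytic_on_disk f -> 0 <= r < 1 ->
  cont2PI (fun t => f (circ r t) * circ r t)%C.
Proof.
  intros Hf Hr t _. apply path_cont_mult; [|apply path_cont_circ].
  eapply path_cont_comp; [|apply path_cont_circ]. apply has_cderiv_C_derive; [exact Hf|].
  unfold unit_disk. rewrite Cmod_circ; lra.
Qed.

Lemma has_cderiv_congr (f g : C -> C) (z l m : C) (d : R) : 0 < d ->
  (forall y, Cmod (y - z) < d -> f y = g y) ->
  has_cderiv f z l -> has_cderiv g z m -> l = m.
Proof.
  intros Hd E Hf Hg. rewrite <- (has_cderiv_unique g z m Hg).
  symmetry. apply has_cderiv_unique. eapply has_cderiv_ext_loc; eauto.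
Qed.

Lemma near_in_ball (r : R) (z y : C) : Cmod (y - z) < r - Cmod z -> Cmod y < r.
Proof.
  intros H. replace y with ((y - z) + z)%C by ring.
  eapply Rle_lt_trans; [apply Cmod_triangle|]. lra.
Qed.

(** Used repeatedly: each application passes to the next kernel power, and [c] accumulates the
    factorial. *)
Lemma deriv_of_cauchy_int (f df : C -> C) (c : C) (r : R) (g : R -> C) (n : nat) :
  cont2PI g ->
  (forall z, Cmod z < r -> f z = (c * cauchy_int r g n z)%C) ->
  (forall z, Cmod z < r -> has_cderiv f z (df z)) ->
  forall z, Cmod z < r -> df z = (c * RtoC (INR n) * cauchy_int r g (S n) z)%C.
Proof.
  intros Hg E Hd z Hz.
  apply (has_cderiv_congr f (fun y => c * cauchy_int r g n y)%C z _ _ (r - Cmod z)); [lra| |now apply Hd|].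
  - intros y Hy. apply E. now apply near_in_ball with z.
  - eapply has_cderiv_eq.
    2:{ apply has_cderiv_mult; [apply has_cderiv_const|now apply has_cderiv_cauchy_int]. }
    cbv beta. ring.
Qed.

(** The integral formula is available for the primitive F before anything is known about continuity
    of f'. Then f and f' are Cauchy integrals over the density of F with kernel powers 2 and 3, and
    the latter can be differentiated once more. *)
Lemma analytic_C_derive (f : C -> C) : analytic_on_disk f -> analytic_on_disk (C_derive f).
Proof.
  intros Hf z0 Hz0. unfold unit_disk in Hz0. pose proof (Cmod_ge_0 z0).
  set (r := (1 + Cmod z0) / 2). assert (Hr : r < 1) by (unfold r; lra).
  assert (Hz : Cmod z0 < r) by (unfold r; lra).
  set (F := SInt f 0).
  pose proof (analytic_has_primitive f Hf) as HF. fold F in HF.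
  assert (HFa : analytic_on_disk F) by (eapply analytic_of_has_cderiv; exact HF).
  set (g := fun t => (F (circ r t) * circ r t)%C).
  assert (Hg : cont2PI g) by (apply cont2PI_circle_density; [exact HFa|lra]).
  assert (U : forall z, Cmod z < r -> unit_disk z) by (unfold unit_disk; intros; lra).
  assert (E1 : forall z, Cmod z < r -> F z = (1 * cauchy_int r g 1 z)%C).
  { intros z Hzz. rewrite Cmult_1_l. apply (cauchy_formula_C1 F f (C_derive f)); auto.
    intros; now apply has_cderiv_C_derive. }
  assert (E2 := deriv_of_cauchy_int F f _ r g 1 Hg E1 (fun z Hzz => HF z (U z Hzz))).
  assert (E3 := deriv_of_cauchy_int f (C_derive f) _ r g 2 Hg E2
    (fun z Hzz => has_cderiv_C_derive f z Hf (U z Hzz))).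
  eexists. apply has_cderiv_is_derive.
  eapply has_cderiv_ext_loc with (d := r - Cmod z0); [lra| |].
  - intros y Hy. symmetry. apply E3. now apply near_in_ball with z0.
  - apply has_cderiv_mult; [apply has_cderiv_const|now apply has_cderiv_cauchy_int].
Qed.

Lemma cauchy_formula (f : C -> C) (r : R) (z : C) : analytic_on_disk f ->
  r < 1 -> Cmod z < r -> f z = cauchy_int r (fun t => f (circ r t) * circ r t)%C 1 z.
Proof.
  intros Hf Hr Hz.
  apply (cauchy_formula_C1 f (C_derive f) (C_derive (C_derive f))); auto.
  - intros; now apply has_cderiv_C_derive.
  - intros; apply has_cderiv_C_derive; [now apply analytic_C_derive|assumption].
Qed.

Lemma cauchy_coefficients (f : C -> C) (r : R) : analytic_on_disk f -> 0 < r < 1 ->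
  f 0 = cmean (fun t => f (circ r t)) /\
  C_derive f 0 = cmean (fun t => f (circ r t) * / circ r t)%C /\
  C_derive (C_derive f) 0 = (2 * cmean (fun t => f (circ r t) * (/ circ r t * / circ r t)))%C.
Proof.
  intros Hf Hr.
  set (g := fun t => (f (circ r t) * circ r t)%C).
  assert (Hg : cont2PI g) by (apply cont2PI_circle_density; [exact Hf|lra]).
  assert (U : forall z, Cmod z < r -> unit_disk z) by (unfold unit_disk; intros; lra).
  assert (E1 : forall z, Cmod z < r -> f z = (1 * cauchy_int r g 1 z)%C).
  { intros z Hz. rewrite Cmult_1_l. now apply cauchy_formula. }
  assert (E2 := deriv_of_cauchy_int f (C_derive f) _ r g 1 Hg E1
    (fun z Hzz => has_cderiv_C_derive f z Hf (U z Hzz))).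
  assert (E3 := deriv_of_cauchy_int (C_derive f) (C_derive (C_derive f)) _ r g 2 Hg E2
    (fun z Hzz => has_cderiv_C_derive _ z (analytic_C_derive f Hf) (U z Hzz))).
  assert (H0 : Cmod 0 < r) by (rewrite Cmod_0; lra).
  assert (N : forall t, circ r t <> 0).
  { intros t E. assert (K := Cmod_circ r t ltac:(lra)). rewrite E, Cmod_0 in K. lra. }
  assert (Z : forall t, (circ r t - 0)%C = circ r t) by (intros; ring).
  split; [|split].
  - rewrite (E1 0 H0), Cmult_1_l. apply cmean_ext. intros t. unfold g. rewrite Z. simpl. field. apply N.
  - rewrite (E2 0 H0). simpl INR. rewrite !Cmult_1_l. apply cmean_ext. intros t. unfold g. rewrite Z. simpl. field. apply N.
  - rewrite (E3 0 H0). replace (1 * INR 1 * INR 2)%C with (RtoC 2) by (apply C_ext; simpl; ring).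
    f_equal. apply cmean_ext. intros t. unfold g. rewrite Z. simpl. field. apply N.
Qed.

(** * Coefficients of bounded functions *)

Lemma cis_conj (t : R) : (cis t * Cconj (cis t) = 1)%C.
Proof.
  rewrite <- Cmod2_conj, Cmod_cis. apply C_ext; simpl; ring.
Qed.

Lemma path_cont_cis (t : R) : path_cont cis t.
Proof. eapply path_deriv_cont, path_deriv_cis. Qed.

Lemma cmean_cis : cmean cis = 0.
Proof.
  apply cmean_deriv with (F := fun t => (- Ci * cis t)%C).
  - intros t. eapply path_deriv_eq.
    2:{ apply path_deriv_mult; [apply path_deriv_const|apply path_deriv_cis]. }
    cbv beta. transitivity (- (Ci * Ci) * cis t)%C; [ring|]. rewrite Ci_sq. ring.
  - intros t _. apply path_cont_cis.
  - now rewrite cis_2PI, cis_0.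
Qed.

Lemma cmean_conj (f : R -> C) : cont2PI f -> cmean (fun t => Cconj (f t)) = Cconj (cmean f).
Proof.
  intros Hf. unfold cmean. rewrite Cmult_conj. f_equal.
  - apply C_ext; simpl; ring.
  - unfold CInt. apply C_ext; simpl; [reflexivity|].
    apply (@RInt_opp R_CompleteNormedModule (fun t => Im (f t))).
    apply cont_on_ex_RInt_Im; [pose proof PI2_pos; lra|exact Hf].
Qed.

Lemma cmean_Re_ge0 (f : R -> C) : cont2PI f -> (forall t, 0 <= Re (f t)) -> 0 <= Re (cmean f).
Proof.
  intros Hf H. pose proof PI2_pos as HP. unfold cmean. rewrite re_scal_l.
  apply Rmult_le_pos; [left; now apply Rinv_0_lt_compat|].
  apply RInt_ge_0; [lra| |auto].
  apply cont_on_ex_RInt_Re; [lra|exact Hf].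
Qed.

Lemma Cmod_sq_conj (z : C) : (z * Cconj z)%C = RtoC (Cmod z ^ 2).
Proof. symmetry. apply Cmod2_conj. Qed.

(* Multiplication by a function bounded by 1 is a contraction; Bessel's inequality for the
   coefficients 1 and 2 of [w z * (x + y z)] on the circle of radius [r]. *)
Lemma schwarz_contraction_radius (w : C -> C) (c1 c2 x y : C) (r : R) :
  analytic_on_disk w -> (forall z, unit_disk z -> unit_disk (w z)) -> w 0 = 0 ->
  C_derive w 0 = c1 -> C_derive (C_derive w) 0 = (2 * c2)%C -> 0 < r < 1 ->
  r ^ 4 * (Cmod (x * c1) ^ 2 + Cmod (x * c2 + y * c1) ^ 2) <= Cmod x ^ 2 + Cmod y ^ 2.
Proof.
  intros Hw Hb Hw0 H1 H2 Hr.
  destruct (cauchy_coefficients w r Hw Hr) as [M0 [M1 M2]].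
  rewrite Hw0 in M0. rewrite H1 in M1. rewrite H2 in M2.
  set (W := fun t => w (circ r t)) in *.
  assert (HW : forall t, unit_disk (circ r t)) by (intro t; unfold unit_disk; rewrite Cmod_circ; lra).
  assert (CW : forall t, path_cont W t).
  { intros t. eapply path_cont_comp; [|apply path_cont_circ]. now apply has_cderiv_C_derive. }
  assert (Ce : forall t, path_cont (fun t => Cconj (cis t)) t) by (intro t; apply path_cont_conj, path_cont_cis).
  set (We := fun t => (W t * Cconj (cis t))%C).
  set (Wee := fun t => (W t * (Cconj (cis t) * Cconj (cis t)))%C).
  assert (CWe : forall t, path_cont We t) by (intro t; apply path_cont_mult; auto).
  assert (CWee : forall t, path_cont Wee t) by (intro t; apply path_cont_mult; auto; apply path_cont_mult; auto).
  assert (Cinv_circ : forall t, (RtoC r * / circ r t)%C = Cconj (cis t)).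
  { intros t. unfold circ.
    assert (N : cis t <> 0) by (intro E; pose proof (Cmod_cis t) as K; rewrite E, Cmod_0 in K; lra).
    assert (Nr : RtoC r <> 0) by (intro E; apply RtoC_inj in E; lra).
    transitivity (/ cis t)%C; [field; auto|].
    rewrite <- (Cmult_1_r (/ cis t)). rewrite <- (cis_conj t). field. exact N. }
  assert (E1 : cmean We = (RtoC r * c1)%C).
  { rewrite M1. rewrite <- cmean_scal.
    - apply cmean_ext. intro t. unfold We. rewrite <- (Cinv_circ t). fold (W t). ring.
    - intros t _. apply path_cont_mult; [apply CW|].
      eapply (path_cont_comp (fun y => / y)%C); [apply has_cderiv_inv_id|apply path_cont_circ].
      intro E. assert (K := Cmod_circ r t ltac:(lra)). rewrite E, Cmod_0 in K. lra. }
  assert (E2 : cmean Wee = (RtoC r * RtoC r * c2)%C).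
  { assert (M2' : c2 = cmean (fun t => W t * (/ circ r t * / circ r t))%C).
    { apply (f_equal (Cmult (/ 2))) in M2. rewrite !Cmult_assoc in M2.
      rewrite Cinv_l in M2 by (intro E; apply RtoC_inj in E; lra).
      now rewrite !Cmult_1_l in M2. }
    rewrite M2'. rewrite <- cmean_scal.
    - apply cmean_ext. intro t. unfold Wee. rewrite <- (Cinv_circ t). ring.
    - intros t _. assert (K1 : path_cont (fun t => / circ r t)%C t).
      { eapply (path_cont_comp (fun y => / y)%C); [apply has_cderiv_inv_id|apply path_cont_circ].
        intro E. assert (K := Cmod_circ r t ltac:(lra)). rewrite E, Cmod_0 in K. lra. }
      apply path_cont_mult; [apply CW|]. now apply path_cont_mult. }
  assert (E0 : cmean W = 0) by (now symmetry).
  (* With e = cis t and X = x + r y e, A and B are the first two Fourier coefficients of W X. Put P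
     = A e + B e^2. Then [f] is |X|^2 + |P|^2 - 2 W X conj P, expanded into terms whose means are
     known. Its real part is nonnegative because |W| < 1, and its mean is |x|^2 + r^2 |y|^2 - |A|^2
     - |B|^2. *)
  set (A := (RtoC r * (x * c1))%C). set (B := (RtoC r * RtoC r * (x * c2 + y * c1))%C).
  set (K0 := (x * Cconj x + RtoC r * RtoC r * (y * Cconj y) + A * Cconj A + B * Cconj B)%C).
  set (f := fun t => (K0 + ((RtoC r * y * Cconj x + B * Cconj A) * cis t
     + ((RtoC r * x * Cconj y + A * Cconj B) * Cconj (cis t)
     + ((- RtoC 2 * RtoC r * y * Cconj A) * W t
     + ((- RtoC 2 * (x * Cconj A + RtoC r * y * Cconj B)) * We t
     + (- RtoC 2 * x * Cconj B) * Wee t)))))%C).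
  assert (Pos : forall t, 0 <= Re (f t)).
  { intro t.
    set (X := (x + RtoC r * y * cis t)%C). set (P := (A * cis t + B * (cis t * cis t))%C).
    assert (Ef : f t = (X * Cconj X + P * Cconj P - 2 * (W t * X * Cconj P))%C).
    { unfold f, X, P, K0, We, Wee. rewrite !Cplus_conj, !Cmult_conj.
      replace (Cconj (RtoC r)) with (RtoC r) by (apply C_ext; simpl; ring).
      pose proof (cis_conj t) as H. set (e := cis t) in *. set (e' := Cconj e) in *.
      (* The two expressions agree only modulo e e' = 1. Adding the right multiple of e e' - 1 turns
         the second half into a polynomial identity. *)
      match goal with |- ?l = _ => transitivity (l + (e * e' - 1) * (RtoC r * RtoC r * (y * Cconj y) + A * Cconj A
         + B * Cconj B * (e * e' + 1) + A * Cconj B * e' + B * Cconj A * e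
         - 2 * W t * (RtoC r * y * Cconj A + RtoC r * y * Cconj B * e')))%C end.
      - rewrite H. ring.
      - ring. }
    rewrite Ef. rewrite !Cmod_sq_conj.
    replace (Re (RtoC (Cmod X ^ 2) + RtoC (Cmod P ^ 2) - 2 * (W t * X * Cconj P)))
      with (Cmod X ^ 2 + Cmod P ^ 2 - 2 * Re (W t * X * Cconj P)).
    2:{ unfold Re; simpl. ring. }
    assert (Re (W t * X * Cconj P) <= Cmod X * Cmod P).
    { eapply Rle_trans; [apply Rle_abs|]. eapply Rle_trans; [apply re_le_Cmod|].
      rewrite !Cmod_mult, Cmod_conj. apply Rmult_le_compat_r; [apply Cmod_ge_0|].
      assert (Cmod (W t) < 1) by (apply (Hb _ (HW t))).
      pose proof (Cmod_ge_0 X). nra. }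
    pose proof (pow2_ge_0 (Cmod X - Cmod P)).
    revert H H0. generalize (Re (W t * X * Cconj P)) (Cmod X) (Cmod P). intros. nra. }
  assert (Cs : forall c t, path_cont (fun t => c * cis t)%C t)
    by (intros; apply path_cont_mult; [apply path_cont_const|apply path_cont_cis]).
  assert (Cc : forall c t, path_cont (fun t => c * Cconj (cis t))%C t)
    by (intros; apply path_cont_mult; [apply path_cont_const|apply Ce]).
  assert (CcW : forall c t, path_cont (fun t => c * W t)%C t)
    by (intros; apply path_cont_mult; [apply path_cont_const|apply CW]).
  assert (CcWe : forall c t, path_cont (fun t => c * We t)%C t)
    by (intros; apply path_cont_mult; [apply path_cont_const|apply CWe]).
  assert (CcWee : forall c t, path_cont (fun t => c * Wee t)%C t)
    by (intros; apply path_cont_mult; [apply path_cont_const|apply CWee]).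
  (* Continuity of the successive tails of the sum [f], one for each summand that [cmean_plus]
     splits off. *)
  pose (T4 := fun a b t => path_cont_plus _ _ t (CcWe a t) (CcWee b t)).
  pose (T3 := fun a b c t => path_cont_plus _ _ t (CcW a t) (T4 b c t)).
  pose (T2 := fun a b c d t => path_cont_plus _ _ t (Cc a t) (T3 b c d t)).
  pose (T1 := fun a b c d e t => path_cont_plus _ _ t (Cs a t) (T2 b c d e t)).
  assert (Hmean : cmean f = (x * Cconj x + RtoC r * RtoC r * (y * Cconj y) - A * Cconj A - B * Cconj B)%C).
  { unfold f.
    assert (Cf : forall g, (forall t, path_cont g t) -> cont2PI g) by (intros g Hg t _; apply Hg).
    rewrite cmean_plus; [|apply Cf; intro; apply path_cont_const|apply Cf; intro; apply T1].
    rewrite cmean_plus; [|apply Cf; intro; apply Cs|apply Cf; intro; apply T2].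
    rewrite cmean_plus; [|apply Cf; intro; apply Cc|apply Cf; intro; apply T3].
    rewrite cmean_plus; [|apply Cf; intro; apply CcW|apply Cf; intro; apply T4].
    rewrite cmean_plus; [|apply Cf; intro; apply CcWe|apply Cf; intro; apply CcWee].
    rewrite !cmean_scal; try (apply Cf; auto; intro; apply path_cont_cis).
    rewrite (cmean_conj cis) by (apply Cf; intro; apply path_cont_cis).
    rewrite cmean_const, cmean_cis, E0, E1, E2.
    replace (Cconj 0) with (RtoC 0) by (apply C_ext; simpl; ring).
    unfold K0, A, B. ring. }
  assert (Fin : 0 <= Re (cmean f)).
  { apply cmean_Re_ge0; [|exact Pos]. intros t _. unfold f.
    apply path_cont_plus; [apply path_cont_const|apply T1]. }
  rewrite Hmean, !Cmod_sq_conj in Fin.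
  replace (Re (RtoC (Cmod x ^ 2) + RtoC r * RtoC r * RtoC (Cmod y ^ 2) - RtoC (Cmod A ^ 2) - RtoC (Cmod B ^ 2)))
    with (Cmod x ^ 2 + r * r * Cmod y ^ 2 - Cmod A ^ 2 - Cmod B ^ 2) in Fin
    by (unfold Re; simpl; ring).
  unfold A, B in Fin.
  rewrite (Cmod_mult (RtoC r)), (Cmod_mult (RtoC r * RtoC r)), (Cmod_mult (RtoC r) (RtoC r)), !Cmod_R, (Rabs_pos_eq r) in Fin by lra.
  set (S1 := Cmod (x * c1)) in *. set (S2 := Cmod (x * c2 + y * c1)) in *.
  assert (Hr2 : 0 <= r * r <= 1) by nra.
  assert (Hr4 : r ^ 4 <= r * r) by (replace (r ^ 4) with ((r * r) * (r * r)) by ring; nra).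
  assert (0 <= Cmod y ^ 2) by apply pow2_ge_0.
  assert (0 <= S1 ^ 2) by apply pow2_ge_0.
  replace ((r * S1) ^ 2) with (r * r * S1 ^ 2) in Fin by ring.
  replace ((r * r * S2) ^ 2) with (r ^ 4 * S2 ^ 2) in Fin by ring.
  nra.
Qed.

Lemma schwarz_contraction (w : C -> C) (c1 c2 x y : C) :
  analytic_on_disk w -> (forall z, unit_disk z -> unit_disk (w z)) -> w 0 = 0 ->
  C_derive w 0 = c1 -> C_derive (C_derive w) 0 = (2 * c2)%C ->
  Cmod (x * c1) ^ 2 + Cmod (x * c2 + y * c1) ^ 2 <= Cmod x ^ 2 + Cmod y ^ 2.
Proof.
  intros Hw Hb Hw0 H1 H2.
  set (S := Cmod (x * c1) ^ 2 + Cmod (x * c2 + y * c1) ^ 2).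
  set (T := Cmod x ^ 2 + Cmod y ^ 2).
  assert (HT : 0 <= T) by (unfold T; pose proof (pow2_ge_0 (Cmod x)); pose proof (pow2_ge_0 (Cmod y)); lra).
  destruct (Rle_dec S T) as [L|L]; [exact L|exfalso]. apply Rnot_le_lt in L.
  (* For r = 1 - d, r^4 >= 1 - 4 d, so r^4 S >= S - 4 d S = (S + T) / 2 > T, against the inequality
     on the circle of radius r. *)
  set (d := (S - T) / (8 * S)).
  assert (Hd : 0 < d) by (apply Rdiv_lt_0_compat; lra).
  assert (Hd1 : d * (8 * S) = S - T) by (unfold d; field; lra).
  assert (Hd2 : d <= / 8).
  { apply Rmult_le_reg_r with (8 * S); [lra|]. rewrite Hd1. lra. }
  pose proof (schwarz_contraction_radius w c1 c2 x y (1 - d) Hw Hb Hw0 H1 H2 ltac:(lra)) as K.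
  fold S T in K.
  assert (1 - 4 * d <= (1 - d) ^ 4).
  { replace ((1 - d) ^ 4) with (1 - 4 * d + d * d * (6 - 4 * d + d * d)) by ring. nra. }
  nra.
Qed.

(** [schwarz_contraction] says that the lower triangular Toeplitz matrix with rows (c1, 0) and (c2,
    c1) is a contraction. It is tested on the vectors (1, lam conj(c1) c2). The value lam = 0 gives
    |c1|^2 + |c2|^2 <= 1, which settles the case |c1| = 1. Otherwise lam = 1 / (1 - |c1|^2) turns
    the inequality, with m = |c2| / (1 - |c1|^2), into |c1|^2 + m^2 <= 1 + |c1|^2 m^2, that is m <=
    1. *)
Lemma schwarz_second_coefficient (w : C -> C) (c1 c2 : C) :
  analytic_on_disk w -> (forall z, unit_disk z -> unit_disk (w z)) -> w 0 = 0 ->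
  C_derive w 0 = c1 -> C_derive (C_derive w) 0 = (2 * c2)%C ->
  Cmod c1 <= 1 /\ Cmod c2 <= 1 - Cmod c1 ^ 2.
Proof.
  intros Hw Hb Hw0 H1 H2.
  assert (K : forall lam : R, 0 <= lam ->
    Cmod c1 ^ 2 + (Cmod c2 * (1 + lam * Cmod c1 ^ 2)) ^ 2 <= 1 + (lam * Cmod c1 * Cmod c2) ^ 2).
  { intros lam Hlam.
    pose proof (schwarz_contraction w c1 c2 1 (RtoC lam * (Cconj c1 * c2)) Hw Hb Hw0 H1 H2) as E.
    rewrite Cmult_1_l, Cmod_1 in E.
    replace (1 * c2 + RtoC lam * (Cconj c1 * c2) * c1)%C
      with (c2 * (1 + RtoC lam * (c1 * Cconj c1)))%C in E by ring.
    rewrite Cmod_sq_conj in E.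
    replace (1 + RtoC lam * RtoC (Cmod c1 ^ 2))%C with (RtoC (1 + lam * Cmod c1 ^ 2)) in E
      by (rewrite RtoC_plus, RtoC_mult; reflexivity).
    pose proof (pow2_ge_0 (Cmod c1)).
    rewrite !Cmod_mult, !Cmod_R, Cmod_conj, !Rabs_pos_eq in E by nra.
    rewrite pow1 in E. replace (lam * (Cmod c1 * Cmod c2)) with (lam * Cmod c1 * Cmod c2) in E by ring. exact E. }
  pose proof (Cmod_ge_0 c1) as P1. pose proof (Cmod_ge_0 c2) as P2.
  set (p := Cmod c1) in *. set (q := Cmod c2) in *.
  pose proof (K 0 ltac:(lra)) as K0.
  replace (p ^ 2 + (q * (1 + 0 * p ^ 2)) ^ 2) with (p * p + q * q) in K0 by ring.
  replace (1 + (0 * p * q) ^ 2) with 1 in K0 by ring.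
  assert (Hp : p <= 1) by nra. split; [exact Hp|].
  destruct (Req_dec p 1) as [E|E].
  - rewrite E in *. nra.
  - assert (Hp2 : 0 < 1 - p ^ 2) by nra.
    pose proof (K (/ (1 - p ^ 2)) ltac:(left; now apply Rinv_0_lt_compat)) as K1.
    set (s := 1 - p ^ 2) in *.
    replace (1 + / s * p ^ 2) with (/ s) in K1 by (unfold s; field; unfold s in Hp2; lra).
    replace ((q * / s) ^ 2) with (q ^ 2 * (/ s) ^ 2) in K1 by ring.
    replace ((/ s * p * q) ^ 2) with (p ^ 2 * (q ^ 2 * (/ s) ^ 2)) in K1 by ring.
    set (m := q * / s). assert (Em : q ^ 2 * (/ s) ^ 2 = m * m) by (unfold m; ring).
    rewrite Em in K1.
    assert (Hm : m * m <= 1).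
    { apply Rmult_le_reg_l with s; [exact Hp2|]. unfold s in *. lra. }
    assert (Hm1 : m <= 1) by nra.
    replace q with (m * s) by (unfold m; field; lra). nra.
Qed.

(** * Toeplitz determinant and coefficient relations *)

Lemma toeplitz_det_2_2 (f : C -> C) :
  toeplitz_det f 2 2 = (taylor_coeff f 2 * taylor_coeff f 2 - taylor_coeff f 3 * taylor_coeff f 3)%C.
Proof.
  unfold toeplitz_det. simpl Cdet. rewrite !sum_Sn, !sum_O. simpl.
  unfold plus; simpl.
  replace (-1 * 1) with (-1) by ring. ring.
Qed.

Lemma unit_disk_0 : unit_disk 0.
Proof. unfold unit_disk. rewrite Cmod_0. lra. Qed.

(** Applied to g = f', with the relation defining [class_K] cleared of its denominator.
    Differentiating it once near 0 and once more at 0 replaces the comparison of power series; the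
    factor z removes the highest derivative each time. *)
Lemma log_derivative_coefficients (g Phi : C -> C) (d : R) :
  analytic_on_disk g -> analytic_on_disk Phi -> g 0 = 1 -> Phi 0 = 1 -> 0 < d <= 1 ->
  (forall z, Cmod z < d -> (z * C_derive g z = g z * (Phi z - 1))%C) ->
  C_derive g 0 = C_derive Phi 0 /\
  (2 * C_derive (C_derive g) 0 =
     2 * (C_derive Phi 0 * C_derive Phi 0) + C_derive (C_derive Phi) 0)%C.
Proof.
  intros Hg HPhi Hg0 HP0 Hd E.
  pose proof (analytic_C_derive g Hg) as Hg1. pose proof (analytic_C_derive _ Hg1) as Hg2.
  pose proof (analytic_C_derive Phi HPhi) as HP1.
  assert (D1 : forall z, Cmod z < d ->
    (C_derive g z + z * C_derive (C_derive g) z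
       = C_derive g z * (Phi z - 1) + g z * C_derive Phi z)%C).
  { intros z Hz. assert (Uz : unit_disk z) by (unfold unit_disk; lra).
    apply (has_cderiv_congr (fun y => y * C_derive g y)%C (fun y => g y * (Phi y - 1))%C z _ _ (d - Cmod z)).
    - lra.
    - intros y Hy. apply E. now apply near_in_ball with z.
    - eapply has_cderiv_eq.
      2:{ apply has_cderiv_mult; [apply has_cderiv_id|now apply has_cderiv_C_derive]. }
      cbv beta. ring.
    - eapply has_cderiv_eq.
      2:{ apply has_cderiv_mult; [now apply has_cderiv_C_derive|].
          apply (has_cderiv_plus Phi (fun _ => - (1))%C); [now apply has_cderiv_C_derive|apply has_cderiv_const]. }
      cbv beta. ring. }
  assert (H0 : Cmod 0 < d) by (rewrite Cmod_0; lra).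
  pose proof unit_disk_0 as U0.
  assert (A1 : C_derive g 0 = C_derive Phi 0).
  { pose proof (D1 0 H0) as K. rewrite Hg0, HP0 in K.
    transitivity (C_derive g 0 + 0 * C_derive (C_derive g) 0)%C; [ring|]. rewrite K. ring. }
  split; [exact A1|].
  assert (D2 : (2 * C_derive (C_derive g) 0 + 0 * C_derive (C_derive (C_derive g)) 0
    = C_derive (C_derive g) 0 * (Phi 0 - 1) + 2 * (C_derive g 0 * C_derive Phi 0) + g 0 * C_derive (C_derive Phi) 0)%C).
  { apply (has_cderiv_congr (fun y => C_derive g y + y * C_derive (C_derive g) y)%C
      (fun y => C_derive g y * (Phi y - 1) + g y * C_derive Phi y)%C 0 _ _ d).
    - lra.
    - intros y Hy. apply D1. replace y with (y - 0)%C by ring. exact Hy.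
    - eapply has_cderiv_eq.
      2:{ apply has_cderiv_plus; [now apply has_cderiv_C_derive|].
          apply has_cderiv_mult; [apply has_cderiv_id|now apply has_cderiv_C_derive]. }
      cbv beta. ring.
    - eapply has_cderiv_eq.
      2:{ apply has_cderiv_plus.
          - apply has_cderiv_mult; [now apply has_cderiv_C_derive|].
            apply (has_cderiv_plus Phi (fun _ => - (1))%C); [now apply has_cderiv_C_derive|apply has_cderiv_const].
          - apply has_cderiv_mult; now apply has_cderiv_C_derive. }
      cbv beta. ring. }
  rewrite Hg0, HP0, A1 in D2.
  transitivity (2 * C_derive (C_derive g) 0 + 0 * C_derive (C_derive (C_derive g)) 0)%C; [ring|].
  rewrite D2. ring.
Qed.

Lemma analytic_comp (f w : C -> C) : analytic_on_disk f -> analytic_on_disk w ->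
  (forall z, unit_disk z -> unit_disk (w z)) -> analytic_on_disk (fun z => f (w z)).
Proof.
  intros Hf Hw Hb. apply (analytic_of_has_cderiv _ (fun z => C_derive f (w z) * C_derive w z)%C).
  intros z Hz. apply has_cderiv_comp; apply has_cderiv_C_derive; auto.
Qed.

Lemma comp_derivatives_0 (f w : C -> C) : analytic_on_disk f -> analytic_on_disk w ->
  (forall z, unit_disk z -> unit_disk (w z)) -> w 0 = 0 ->
  C_derive (fun z => f (w z)) 0 = (C_derive f 0 * C_derive w 0)%C /\
  C_derive (C_derive (fun z => f (w z))) 0 =
    (C_derive (C_derive f) 0 * C_derive w 0 * C_derive w 0 + C_derive f 0 * C_derive (C_derive w) 0)%C.
Proof.
  intros Hf Hw Hb Hw0. pose proof unit_disk_0 as U0.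
  assert (D1 : forall z, unit_disk z ->
    C_derive (fun z => f (w z)) z = (C_derive f (w z) * C_derive w z)%C).
  { intros z Hz. apply has_cderiv_unique. apply has_cderiv_comp; apply has_cderiv_C_derive; auto. }
  split; [rewrite D1 by exact U0; now rewrite Hw0|].
  apply has_cderiv_unique.
  apply (has_cderiv_ext_loc (fun z => C_derive f (w z) * C_derive w z)%C _ _ _ 1); [lra| |].
  - intros y Hy. symmetry. apply D1. unfold unit_disk. replace y with (y - 0)%C by ring. exact Hy.
  - eapply has_cderiv_eq.
    2:{ apply has_cderiv_mult.
        - apply has_cderiv_comp; apply has_cderiv_C_derive; auto. now apply analytic_C_derive.
        - apply has_cderiv_C_derive; auto. now apply analytic_C_derive. }
    cbv beta. rewrite Hw0. ring.
Qed.

Lemma subordinate_coefficients (phi f w : C -> C) (B1 B2 : R) :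
  analytic_on_disk phi -> phi 0 = 1 ->
  taylor_coeff phi 1 = RtoC B1 -> taylor_coeff phi 2 = RtoC B2 ->
  class_A f -> analytic_on_disk w -> (forall z, unit_disk z -> unit_disk (w z)) -> w 0 = 0 ->
  (forall z, unit_disk z -> (1 + z * C_derive (C_derive f) z / C_derive f z)%C = phi (w z)) ->
  (2 * taylor_coeff f 2 = RtoC B1 * C_derive w 0)%C /\
  (6 * taylor_coeff f 3 = RtoC B1 * (C_derive (C_derive w) 0 / 2)
     + RtoC (B2 + B1 ^ 2) * (C_derive w 0 * C_derive w 0))%C.
Proof.
  intros Hphi Hphi0 HB1 HB2 [Hf [_ Hf1]] Hw Hb Hw0 E.
  set (Phi := fun z => phi (w z)).
  assert (HPhi : analytic_on_disk Phi) by now apply (analytic_comp phi w).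
  destruct (comp_derivatives_0 phi w Hphi Hw Hb Hw0) as [P1 P2]. fold Phi in P1, P2.
  pose proof (analytic_C_derive f Hf) as Hg. set (g := C_derive f) in *.
  unfold taylor_coeff in *. simpl C_derive_n in *.
  assert (R1 : RtoC (INR (fact 1)) = 1) by (f_equal; simpl; ring).
  assert (R2 : RtoC (INR (fact 2)) = 2) by (f_equal; simpl; ring).
  assert (R3 : RtoC (INR (fact 3)) = 6) by (f_equal; simpl; ring).
  rewrite R1 in *. rewrite R2 in *. rewrite R3 in *.
  fold g in Hf1. fold g.
  assert (Hg0 : g 0 = 1) by (rewrite <- Hf1; field).
  assert (HP0 : Phi 0 = 1) by (unfold Phi; now rewrite Hw0).
  assert (D1 : C_derive phi 0 = RtoC B1) by (rewrite <- HB1; field).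
  assert (D2 : C_derive (C_derive phi) 0 = (2 * RtoC B2)%C) by (rewrite <- HB2; field).
  (* Since g 0 = 1, continuity gives a disk around 0 where g has no zero; the quotient is cleared on
     that disk. *)
  destruct (has_cderiv_continuous g 0 _ (has_cderiv_C_derive g 0 Hg unit_disk_0) 1 Rlt_0_1) as [d [Hd Hgd]].
  destruct (log_derivative_coefficients g Phi (Rmin d 1)) as [L1 L2]; auto.
  { split; [apply Rmin_glb_lt; lra|apply Rmin_r]. }
  { intros z Hz.
    assert (Hz1 : Cmod z < d) by (eapply Rlt_le_trans; [exact Hz|apply Rmin_l]).
    assert (Hz2 : unit_disk z) by (eapply Rlt_le_trans; [exact Hz|apply Rmin_r]).
    assert (Hgz : g z <> 0).
    { intro K. specialize (Hgd z). replace (z - 0)%C with z in Hgd by ring. specialize (Hgd Hz1).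
      rewrite K, Hg0 in Hgd. replace (0 - 1)%C with (- (1))%C in Hgd by ring.
      rewrite Cmod_m1 in Hgd. lra. }
    unfold Phi. rewrite <- (E z Hz2). field. exact Hgz. }
  rewrite P1, D1 in L1. rewrite P1, P2, D1, D2 in L2.
  split.
  - rewrite <- L1. field.
  - rewrite RtoC_plus, RtoC_pow.
    transitivity (2 * C_derive (C_derive g) 0 / 2)%C; [field|]. rewrite L2. simpl. field.
Qed.

Lemma toeplitz_det_bound (phi f : C -> C) (B1 B2 : R) :
  analytic_on_disk phi -> phi 0 = 1 ->
  taylor_coeff phi 1 = RtoC B1 -> taylor_coeff phi 2 = RtoC B2 ->
  0 < B1 <= Rabs (B2 + B1 ^ 2) -> class_K phi f ->
  Cmod (toeplitz_det f 2 2) <= 1 / 36 * (B1 ^ 2 + B2) ^ 2 + 1 / 4 * B1 ^ 2.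
Proof.
  intros Hphi Hphi0 HB1 HB2 HB [[Hf _] [w [Hw [Hb [Hw0 E]]]]].
  destruct (subordinate_coefficients phi f w B1 B2 Hphi Hphi0 HB1 HB2 Hf Hw Hb Hw0 E) as [E2 E3].
  set (c1 := C_derive w 0) in *. set (c2 := (C_derive (C_derive w) 0 / 2)%C) in *.
  destruct (schwarz_second_coefficient w c1 c2 Hw Hb Hw0) as [S1 S2]; [reflexivity| |].
  { unfold c2. field. }
  rewrite toeplitz_det_2_2.
  set (a2 := taylor_coeff f 2) in *. set (a3 := taylor_coeff f 3) in *.
  assert (M2 : 2 * Cmod a2 = B1 * Cmod c1).
  { apply (f_equal Cmod) in E2. rewrite !Cmod_mult, !Cmod_R, !Rabs_pos_eq in E2 by lra. exact E2. }
  set (M := Rabs (B2 + B1 ^ 2)) in *.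
  assert (M3 : 6 * Cmod a3 <= M).
  { apply (f_equal Cmod) in E3. rewrite Cmod_mult, Cmod_R, Rabs_pos_eq in E3 by lra. rewrite E3.
    eapply Rle_trans; [apply Cmod_triangle|].
    rewrite !Cmod_mult, !Cmod_R, (Rabs_pos_eq B1) by lra. fold M.
    pose proof (Cmod_ge_0 c1) as Hp. pose proof (Cmod_ge_0 c2).
    assert (K1 : B1 * Cmod c2 <= B1 * (1 - Cmod c1 ^ 2)) by (apply Rmult_le_compat_l; lra).
    assert (K2 : B1 * (1 - Cmod c1 ^ 2) <= M * (1 - Cmod c1 ^ 2)) by (apply Rmult_le_compat_r; lra).
    nra. }
  unfold Cminus. eapply Rle_trans; [apply Cmod_triangle|]. rewrite Cmod_opp, !Cmod_mult.
  pose proof (Cmod_ge_0 a2). pose proof (Cmod_ge_0 a3). pose proof (Cmod_ge_0 c1).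
  assert (MM : (B1 ^ 2 + B2) ^ 2 = M * M).
  { unfold M. rewrite <- Rabs_mult. rewrite Rabs_pos_eq; [ring|]. apply Rle_0_sqr. }
  rewrite MM. assert (Cmod a2 <= B1 / 2) by nra. nra.
Qed.

(** * Complex exponential and removable singularity *)

Definition Cexp (z : C) : C := (RtoC (exp (Re z)) * cis (Im z))%C.

Lemma cis_plus (s t : R) : cis (s + t) = (cis s * cis t)%C.
Proof. unfold cis. rewrite cos_plus, sin_plus. apply C_ext; simpl; ring. Qed.

Lemma Cexp_plus (z w : C) : Cexp (z + w) = (Cexp z * Cexp w)%C.
Proof.
  unfold Cexp. rewrite re_plus. replace (Im (z + w)) with (Im z + Im w) by (unfold Im; simpl; ring).
  rewrite exp_plus, cis_plus, RtoC_mult. ring.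
Qed.

Lemma Cexp_0 : Cexp 0 = 1.
Proof. unfold Cexp. simpl. rewrite exp_0, cis_0. ring. Qed.

Lemma Cmod_Cexp (z : C) : Cmod (Cexp z) = exp (Re z).
Proof.
  unfold Cexp. rewrite Cmod_mult, Cmod_cis, Cmod_R, Rabs_pos_eq; [ring|].
  left. apply exp_pos.
Qed.

Lemma Cexp_neq_0 (z : C) : Cexp z <> 0.
Proof. apply Cmod_gt_0. rewrite Cmod_Cexp. apply exp_pos. Qed.

Lemma has_cderiv_Cexp_0 : has_cderiv Cexp 0 1.
Proof.
  (* The error is split below into three terms, bounded by 3 e |h|, 2 d |h| and e |h|. With e <= eps
     / 8 and d <= eps / 4 they add up to at most eps |h|. *)
  intros eps Heps. set (e := Rmin 1 (eps / 8)).
  assert (He : 0 < e) by (apply Rmin_glb_lt; lra).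
  assert (He1 : e <= 1) by apply Rmin_l. assert (He2 : e <= eps / 8) by apply Rmin_r.
  assert (Dexp : is_derive exp 0 1).
  { apply is_derive_Reals. rewrite <- exp_0. apply derivable_pt_lim_exp. }
  destruct (proj1 (is_derive_eps exp 0 1) Dexp e He) as [d1 [Hd1 K1]].
  destruct (proj1 (path_deriv_eps cis 0 _) (path_deriv_cis 0) e He) as [d2 [Hd2 K2]].
  set (d := Rmin (Rmin d1 d2) (Rmin 1 (eps / 4))).
  assert (Hd : 0 < d) by (repeat apply Rmin_glb_lt; lra).
  assert (L1 : d <= d1) by (eapply Rle_trans; [apply Rmin_l|apply Rmin_l]).
  assert (L2 : d <= d2) by (eapply Rle_trans; [apply Rmin_l|apply Rmin_r]).
  assert (L3 : d <= 1) by (eapply Rle_trans; [apply Rmin_r|apply Rmin_l]).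
  assert (L4 : d <= eps / 4) by (eapply Rle_trans; [apply Rmin_r|apply Rmin_r]).
  exists d. split; [exact Hd|]. intros h Hh.
  replace (h - 0)%C with h in * by ring.
  rewrite Cexp_0. set (x := Re h). set (y := Im h).
  assert (Hx : Rabs x <= Cmod h) by apply re_le_Cmod.
  assert (Hy : Rabs y <= Cmod h) by apply Im_le_Cmod.
  specialize (K1 x). specialize (K2 y). rewrite Rminus_0_r in *.
  specialize (K1 ltac:(lra)). specialize (K2 ltac:(lra)).
  rewrite exp_0, Rmult_1_l in K1. rewrite cis_0, Cmult_1_r in K2.
  assert (Eh : h = (RtoC x + Ci * RtoC y)%C) by (apply C_ext; unfold x, y, Re, Im; simpl; ring).
  replace (Cexp h - 1 - 1 * h)%C
    with (RtoC (exp x) * (cis y - 1 - Ci * RtoC y) + RtoC (exp x - 1) * (Ci * RtoC y) + RtoC (exp x - 1 - x))%C.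
  2:{ unfold Cexp. fold x y. rewrite Eh at 1. rewrite !RtoC_minus. ring. }
  eapply Rle_trans; [apply Cmod_triangle|].
  eapply Rle_trans; [apply Rplus_le_compat_r, Cmod_triangle|].
  rewrite !Cmod_mult, Cmod_Ci, !Cmod_R.
  pose proof (exp_pos x) as Ex. rewrite (Rabs_pos_eq (exp x)) by lra.
  pose proof (Rabs_pos x). pose proof (Rabs_pos y).
  assert (M1 : Rabs (exp x - 1) <= 2 * Cmod h).
  { replace (exp x - 1) with ((exp x - 1 - x) + x) by ring.
    eapply Rle_trans; [apply Rabs_triang|]. nra. }
  assert (M2 : exp x <= 3).
  { pose proof (Rle_abs (exp x - 1)). lra. }
  assert (T1 : exp x * Cmod (cis y - 1 - Ci * RtoC y) <= 3 * (e * Cmod h)).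
  { apply Rmult_le_compat; [lra|apply Cmod_ge_0|exact M2|].
    eapply Rle_trans; [exact K2|]. apply Rmult_le_compat_l; lra. }
  assert (T2 : Rabs (exp x - 1) * (1 * Rabs y) <= (2 * d) * Cmod h).
  { rewrite Rmult_1_l. apply Rmult_le_compat; [apply Rabs_pos|apply Rabs_pos|lra|exact Hy]. }
  assert (T3 : Rabs (exp x - 1 - x) <= e * Cmod h).
  { eapply Rle_trans; [exact K1|]. apply Rmult_le_compat_l; lra. }
  pose proof (Cmod_ge_0 h). nra.
Qed.

Lemma has_cderiv_Cexp (z : C) : has_cderiv Cexp z (Cexp z).
Proof.
  apply (has_cderiv_ext (fun y => Cexp z * Cexp (y - z))%C).
  { intros y. rewrite <- Cexp_plus. f_equal. ring. }
  eapply has_cderiv_eq.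
  2:{ apply has_cderiv_mult; [apply has_cderiv_const|].
      apply (has_cderiv_comp Cexp (fun y => y - z)%C).
      - replace (z - z)%C with (RtoC 0) by ring. apply has_cderiv_Cexp_0.
      - apply (has_cderiv_plus (fun y => y) (fun _ => - z)%C); [apply has_cderiv_id|apply has_cderiv_const]. }
  cbv beta. ring.
Qed.

(** Since zeta / (zeta - z) - 1 = z / (zeta - z), dropping the factor zeta from the density in
    Cauchy's formula yields (f z - f 0) / z, in a form that is analytic at 0 too. This integral is
    used for |z| < 1/2 and the plain quotient elsewhere; both agree off 0, so the seam causes no
    loss of differentiability. *)
Lemma analytic_divided_difference_0 (f : C -> C) : analytic_on_disk f ->
  exists q, analytic_on_disk q /\ forall z, unit_disk z -> (z * q z = f z - f 0)%C.
Proof.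
  intros Hf.
  set (r := / 2). assert (Hr : r < 1) by (unfold r; lra). assert (Hr0 : 0 < r) by (unfold r; lra).
  set (q0 := cauchy_int r (fun t => f (circ r t)) 1).
  assert (Hc : forall t, path_cont (fun t => f (circ r t)) t).
  { intros t. eapply path_cont_comp; [|apply path_cont_circ]. apply has_cderiv_C_derive; [exact Hf|].
    unfold unit_disk. rewrite Cmod_circ; lra. }
  assert (Hq0 : forall z, Cmod z < r -> (z * q0 z = f z - f 0)%C).
  { intros z Hz. assert (H0 : Cmod 0 < r) by (rewrite Cmod_0; lra).
    rewrite (cauchy_formula f r z Hf Hr Hz), (cauchy_formula f r 0 Hf Hr H0).
    assert (Cd : cont2PI (fun t => f (circ r t) * circ r t)%C) by (apply cont2PI_circle_density; [exact Hf|lra]).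
    unfold q0, cauchy_int. rewrite <- cmean_scal, <- cmean_minus.
    - apply cmean_ext. intros t.
      pose proof (circ_minus_neq0 r t z Hz) as N1. pose proof (circ_minus_neq0 r t 0 H0) as N2.
      replace (circ r t - 0)%C with (circ r t) in * by ring.
      simpl. field. auto.
    - now apply (cauchy_int_cont r (fun t => f (circ r t) * circ r t)%C).
    - now apply (cauchy_int_cont r (fun t => f (circ r t) * circ r t)%C).
    - apply (cauchy_int_cont r (fun t => f (circ r t))); [exact Hz|]. intros t _. apply Hc. }
  set (q := fun z => if Rlt_dec (Cmod z) r then q0 z else ((f z - f 0) * / z)%C).
  assert (Hq : forall z, unit_disk z -> (z * q z = f z - f 0)%C).
  { intros z Hz. unfold q. destruct (Rlt_dec _ _) as [L|L]; [now apply Hq0|].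
    field. intro E. rewrite E, Cmod_0 in L. lra. }
  exists q. split; [|exact Hq].
  intros z Hz.
  destruct (Rlt_dec (Cmod z) r) as [L|L].
  - eexists. apply has_cderiv_is_derive.
    eapply has_cderiv_ext_loc with (d := r - Cmod z); [lra| |].
    + intros y Hy. unfold q. destruct (Rlt_dec (Cmod y) r) as [L'|L']; [reflexivity|].
      exfalso. apply L'. now apply near_in_ball with z.
    + apply has_cderiv_cauchy_int; [exact L|]. intros t _. apply Hc.
  - assert (Nz : z <> 0) by (intro E; rewrite E, Cmod_0 in L; lra).
    unfold unit_disk in Hz. pose proof (proj1 (Cmod_gt_0 z) Nz) as Pz.
    eexists. apply has_cderiv_is_derive.
    eapply (has_cderiv_ext_loc (fun y => (f y - f 0) * / y)%C) with (d := Rmin (Cmod z) (1 - Cmod z)).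
    + apply Rmin_glb_lt; lra.
    + intros y Hy.
      assert (Hy1 : Cmod (y - z) < Cmod z) by (eapply Rlt_le_trans; [exact Hy|apply Rmin_l]).
      assert (Hy2 : Cmod (y - z) < 1 - Cmod z) by (eapply Rlt_le_trans; [exact Hy|apply Rmin_r]).
      assert (Ny : y <> 0).
      { intro E. rewrite E in Hy1. replace (0 - z)%C with (- z)%C in Hy1 by ring.
        rewrite Cmod_opp in Hy1. lra. }
      assert (Uy : unit_disk y) by (now apply near_in_ball with z).
      rewrite <- (Hq y Uy). field. exact Ny.
    + apply has_cderiv_mult.
      * apply (has_cderiv_plus f (fun _ => - f 0)%C); [now apply has_cderiv_C_derive|apply has_cderiv_const].
      * now apply has_cderiv_inv_id.
Qed.

(** * Univalence of convex functions *)

Lemma polar_unit (x y : R) : x ^ 2 + y ^ 2 = 1 ->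
  exists t, 0 <= t <= 2 * PI /\ (x, y) = cis t.
Proof.
  intros H. assert (Hx : -1 <= x <= 1) by nra.
  pose proof (acos_bound x) as B. pose proof (cos_acos x Hx) as E.
  pose proof (sin2_cos2 (acos x)) as S. rewrite E in S. unfold Rsqr in S.
  assert (S0 : 0 <= sin (acos x)) by (apply sin_ge_0; lra).
  destruct (Rle_dec 0 y) as [L|L].
  - exists (acos x). split; [lra|]. unfold cis. rewrite E. f_equal. nra.
  - exists (2 * PI - acos x). split; [lra|]. unfold cis.
    rewrite cos_minus, sin_minus, cos_2PI, sin_2PI, E. f_equal; nra.
Qed.

Lemma polar_form (v : C) : exists t, 0 <= t <= 2 * PI /\ v = (RtoC (Cmod v) * cis t)%C.
Proof.
  pose proof PI2_pos.
  destruct (Req_dec (Cmod v) 0) as [E|E].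
  - exists 0. split; [lra|]. rewrite E. rewrite (Cmod_eq_0 v E). ring.
  - pose proof (Cmod2_alt v) as K.
    destruct (polar_unit (Re v / Cmod v) (Im v / Cmod v)) as [t [Ht Et]].
    { replace ((Re v / Cmod v) ^ 2 + (Im v / Cmod v) ^ 2) with ((Re v ^ 2 + Im v ^ 2) / Cmod v ^ 2) by (field; exact E).
      rewrite <- K. field. exact E. }
    exists t. split; [exact Ht|]. rewrite <- Et. apply C_ext; simpl; field; exact E.
Qed.

(** The radius is also an argument of P, so a local bound [r <= / d] or a local gap [r <= M - d]
    becomes uniform over the rectangle. The gauge for [compactness_value_2d] must be total, hence
    the choice of radii with default 1 outside. The double negation is inherited from there and
    disappears for the decidable inequalities to which the lemma is applied. *)
Lemma compact_rectangle_uniform (U : R -> R -> R) (a b a' b' : R) (P : posreal -> R -> Prop) :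
  (forall (d e : posreal) r, d <= e -> P e r -> P d r) ->
  (forall x y, a <= x <= b -> a' <= y <= b' -> exists d : posreal, 
     forall u v, Rabs (u - x) < d -> Rabs (v - y) < d -> P d (U u v)) ->
  exists d : posreal, forall x y, a <= x <= b -> a' <= y <= b' -> ~ ~ P d (U x y).
Proof.
  intros Mono Loc.
  assert (Tot : forall xy : R * R, exists d : posreal, a <= fst xy <= b -> a' <= snd xy <= b' ->
     forall u v, Rabs (u - fst xy) < d -> Rabs (v - snd xy) < d -> P d (U u v)).
  { intros [x y]. simpl. destruct (excluded_middle_informative (a <= x <= b /\ a' <= y <= b')) as [[H1 H2]|N].
    - destruct (Loc x y H1 H2) as [d Hd]. exists d. auto.
    - exists (mkposreal 1 Rlt_0_1). intros H1 H2. tauto. }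
  set (delta := fun x y => proj1_sig (constructive_indefinite_description _ (Tot (x, y)))).
  destruct (compactness_value_2d a b a' b' delta) as [d Hd].
  exists d. intros x y Hx Hy N. apply (Hd x y Hx Hy).
  intros [u [v [Hu [Hv [H1 [H2 H3]]]]]]. apply N.
  unfold delta in *. destruct (constructive_indefinite_description _ (Tot (u, v))) as [e He]; simpl in *.
  apply Mono with e; [exact H3|]. now apply He.
Qed.

Lemma continuity_2d_attains_max (U : R -> R -> R) (a b a' b' : R) : a <= b -> a' <= b' ->
  (forall x y, a <= x <= b -> a' <= y <= b' -> continuity_2d_pt U x y) ->
  exists x0 y0, a <= x0 <= b /\ a' <= y0 <= b' /\
    forall x y, a <= x <= b -> a' <= y <= b' -> U x y <= U x0 y0.
Proof.
  intros Hab Hab' HU.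
  assert (Bd : exists M, forall x y, a <= x <= b -> a' <= y <= b' -> U x y <= M).
  { destruct (compact_rectangle_uniform U a b a' b' (fun d r => r <= / d)) as [d Hd].
    - intros d e r H1 H2. eapply Rle_trans; [exact H2|]. apply Rinv_le_contravar; [apply cond_pos|exact H1].
    - intros x y Hx Hy. destruct (HU x y Hx Hy (mkposreal 1 Rlt_0_1)) as [d Hd]. simpl in Hd.
      set (m := / (Rabs (U x y) + 1)). pose proof (Rabs_pos (U x y)) as H0.
      assert (Hm : 0 < m) by (apply Rinv_0_lt_compat; lra).
      assert (Hdm : 0 < Rmin d m) by (apply Rmin_glb_lt; [apply cond_pos|exact Hm]).
      exists (mkposreal _ Hdm). simpl. intros u v Hu Hv.
      assert (Lu : Rabs (u - x) < d) by (eapply Rlt_le_trans; [exact Hu|apply Rmin_l]).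
      assert (Lv : Rabs (v - y) < d) by (eapply Rlt_le_trans; [exact Hv|apply Rmin_l]).
      specialize (Hd u v Lu Lv). apply Rabs_def2 in Hd.
      apply Rle_trans with (/ m).
      + unfold m. rewrite Rinv_inv. pose proof (Rle_abs (U x y)). lra.
      + apply Rinv_le_contravar; [exact Hdm|apply Rmin_r].
    - exists (/ d). intros x y Hx Hy. destruct (Rle_dec (U x y) (/ d)) as [L|L]; [exact L|].
      exfalso. now apply (Hd x y Hx Hy). }
  destruct Bd as [M0 HM0].
  destruct (completeness (fun r => exists x y, a <= x <= b /\ a' <= y <= b' /\ r = U x y)) as [M [HM1 HM2]].
  { exists M0. intros r [x [y [Hx [Hy ->]]]]. now apply HM0. }
  { exists (U a a'), a, a'. repeat split; lra. }
  destruct (excluded_middle_informative (exists x0 y0, a <= x0 <= b /\ a' <= y0 <= b' /\ U x0 y0 = M))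
    as [[x0 [y0 [Hx0 [Hy0 E]]]]|N].
  { exists x0, y0. split; [exact Hx0|]. split; [exact Hy0|]. intros x y Hx Hy. rewrite E.
    apply HM1. exists x, y. auto. }
  exfalso.
  destruct (compact_rectangle_uniform U a b a' b' (fun d r => r <= M - d)) as [d Hd].
  - intros d e r H1 H2. lra.
  - intros x y Hx Hy.
    assert (L : U x y < M).
    { destruct (Rle_lt_or_eq_dec (U x y) M) as [L|E]; [apply HM1; exists x, y; auto|exact L|].
      exfalso. apply N. exists x, y. auto. }
    assert (Hg : 0 < (M - U x y) / 2) by lra.
    destruct (HU x y Hx Hy (mkposreal _ Hg)) as [d Hd]. simpl in Hd.
    assert (Hdm : 0 < Rmin d ((M - U x y) / 2)) by (apply Rmin_glb_lt; [apply cond_pos|exact Hg]).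
    exists (mkposreal _ Hdm). simpl. intros u v Hu Hv.
    assert (Lu : Rabs (u - x) < d) by (eapply Rlt_le_trans; [exact Hu|apply Rmin_l]).
    assert (Lv : Rabs (v - y) < d) by (eapply Rlt_le_trans; [exact Hv|apply Rmin_l]).
    specialize (Hd u v Lu Lv). apply Rabs_def2 in Hd.
    pose proof (Rmin_r d ((M - U x y) / 2)). lra.
  - assert (K : M <= M - d).
    { apply HM2. intros r [x [y [Hx [Hy ->]]]].
      destruct (Rle_dec (U x y) (M - d)) as [L|L]; [exact L|]. exfalso. now apply (Hd x y Hx Hy). }
    pose proof (cond_pos d). lra.
Qed.

Lemma Re_path_deriv_mult_const (c : C) (g : R -> C) (t : R) (l : C) :
  path_deriv g t l -> is_derive (fun s => Re (c * g s)) t (Re (c * l)).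
Proof.
  intros H. assert (K : path_deriv (fun s => c * g s)%C t (c * l)).
  { eapply path_deriv_eq; [|apply path_deriv_mult; [apply path_deriv_const|exact H]]. cbv beta. ring. }
  apply K.
Qed.

(* Along the circle through [z2] the real function [Re (conj n * f)], [n = z2 f'(z2)], has
   derivative [- |n| |z f'(z)| sin beta], where the turning angle [beta] of the tangent
   increases from 0 to 2 PI. *)
Lemma convex_circle_supporting_line (f p dp : C -> C) (z2 : C) (psi : R) :
  (forall z, unit_disk z -> has_cderiv f z (Cexp (p z))) ->
  (forall z, unit_disk z -> has_cderiv p z (dp z)) ->
  (forall z, unit_disk z -> 0 < Re (1 + z * dp z)) ->
  unit_disk z2 -> z2 <> 0 -> 0 < psi < 2 * PI ->
  Re (Cconj (z2 * Cexp (p z2)) * f (z2 * cis psi)%C) < Re (Cconj (z2 * Cexp (p z2)) * f z2).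
Proof.
  intros Hf Hp Hpos Hz2 Nz2 Hpsi.
  set (n := (z2 * Cexp (p z2))%C).
  set (z := fun t => (z2 * cis t)%C).
  assert (Uz : forall t, unit_disk (z t)).
  { intros t. unfold unit_disk, z. rewrite Cmod_mult, Cmod_cis. unfold unit_disk in Hz2. lra. }
  assert (Dz : forall t, path_deriv z t (Ci * z t)).
  { intros t. unfold z. eapply path_deriv_eq; [|apply path_deriv_mult; [apply path_deriv_const|apply path_deriv_cis]].
    cbv beta. ring. }
  (* This is the argument of z f'(z) relative to its value at z2. Writing f' as [Cexp] of p makes it
     a globally defined real function, with no branch to choose; its derivative is the positive
     quantity Re (1 + z f'' / f'). *)
  set (beta := fun t => t + Im (p (z t)) - Im (p z2)).
  set (h := fun t => Re (Cconj n * f (z t))).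
  (* The amplitude |n| |z f'(z)|; the square appears because z2 and z t have the same modulus. *)
  set (A := fun t => (Cmod z2) ^ 2 * (exp (Re (p z2)) * exp (Re (p (z t))))).
  assert (HA : forall t, 0 < A t).
  { intros t. unfold A. apply Rmult_lt_0_compat.
    - apply pow_lt. now apply Cmod_gt_0.
    - apply Rmult_lt_0_compat; apply exp_pos. }
  assert (Dbeta : forall t, is_derive beta t (Re (1 + z t * dp (z t)))).
  { intros t. unfold beta.
    replace (Re (1 + z t * dp (z t))) with (1 + Im (dp (z t) * (Ci * z t)) - 0).
    2:{ unfold Re, Im; simpl. ring. }
    apply (is_derive_minus (fun t => t + Im (p (z t))) (fun _ => Im (p z2))).
    - apply (is_derive_plus (fun t => t) (fun t => Im (p (z t)))).
      + exact (@is_derive_id R_AbsRing t).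
      + apply (path_deriv_comp p z t (dp (z t)) (Ci * z t)); auto.
    - exact (@is_derive_const R_AbsRing R_NormedModule (Im (p z2)) t). }
  assert (Mono : forall s t, s < t -> beta s < beta t).
  { intros s t Hst. apply (incr_function beta m_infty p_infty (fun t => Re (1 + z t * dp (z t)))).
    - intros x _ _. apply Dbeta.
    - intros x _ _. apply (Hpos (z x)), Uz.
    - exact I.
    - exact Hst.
    - exact I. }
  assert (Dh : forall t, is_derive h t (- A t * sin (beta t))).
  { intros t. unfold h.
    replace (- A t * sin (beta t)) with (Re (Cconj n * (Cexp (p (z t)) * (Ci * z t)))).
    - apply Re_path_deriv_mult_const. apply path_deriv_comp; auto.
    - unfold A, beta, n. generalize (p (z t)) (p z2). intros p1 p2.
      unfold Cexp, z, cis. rewrite sin_minus, sin_plus, cos_plus, Cmod2_alt.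
      generalize (exp (Re p1)) (exp (Re p2)). intros e1 e2.
      unfold Re, Im; simpl. ring. }
  assert (h0 : h 0 = Re (Cconj n * f z2)).
  { unfold h, z. rewrite cis_0. f_equal. f_equal. f_equal. ring. }
  assert (h2 : h (2 * PI) = h 0) by (unfold h, z; now rewrite cis_2PI, cis_0).
  assert (b0 : beta 0 = 0).
  { unfold beta, z. rewrite cis_0. replace (z2 * 1)%C with z2 by ring. ring. }
  assert (b2 : beta (2 * PI) = 2 * PI).
  { unfold beta, z. rewrite cis_2PI. replace (z2 * 1)%C with z2 by ring. ring. }
  fold (z psi). change (h psi < Re (Cconj n * f z2)). rewrite <- h0.
  (* While [beta] is below PI, h falls from its value at z2; beyond PI it climbs back to that value
     at 2 PI. One mean value argument, from 0 or towards 2 PI, therefore suffices. *)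
  destruct (Rle_dec (beta psi) PI) as [L|L].
  - destruct (MVT_cor2 h (fun t => - A t * sin (beta t)) 0 psi) as [c [E Hc]]; [lra| |].
    { intros t _. apply is_derive_Reals, Dh. }
    assert (S : 0 < sin (beta c)).
    { apply sin_gt_0; [rewrite <- b0; apply Mono; lra|].
      apply Rlt_le_trans with (beta psi); [apply Mono; lra|exact L]. }
    specialize (HA c). assert (0 < A c * sin (beta c)) by now apply Rmult_lt_0_compat. nra.
  - apply Rnot_le_lt in L.
    destruct (MVT_cor2 h (fun t => - A t * sin (beta t)) psi (2 * PI)) as [c [E Hc]]; [lra| |].
    { intros t _. apply is_derive_Reals, Dh. }
    assert (S : sin (beta c) < 0).
    { apply sin_lt_0; [apply Rlt_trans with (beta psi); [exact L|apply Mono; lra]|].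
      rewrite <- b2. apply Mono; lra. }
    specialize (HA c). assert (0 < A c * - sin (beta c)) by (apply Rmult_lt_0_compat; lra). nra.
Qed.

(** Moving from z0 in the direction conj (n l) changes Re (n f) at the rate |n l|^2 > 0. *)
Lemma Re_no_interior_max (f : C -> C) (n z0 l : C) (eta : R) :
  has_cderiv f z0 l -> n <> 0 -> l <> 0 -> 0 < eta ->
  exists z, Cmod (z - z0) < eta /\ Re (n * f z0) < Re (n * f z).
Proof.
  intros Hf Hn Hl Heta.
  set (D := (n * l)%C). assert (ND : D <> 0) by now apply Cmult_neq_0.
  pose proof (proj1 (Cmod_gt_0 D) ND) as PD.
  set (g := fun s => (z0 + RtoC s * Cconj D)%C).
  assert (g0 : g 0 = z0) by (unfold g; ring).
  assert (Dg : path_deriv g 0 (Cconj D)).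
  { unfold g. eapply path_deriv_eq.
    2:{ apply path_deriv_plus; [apply path_deriv_const|].
        apply path_deriv_mult; [apply path_deriv_RtoC|apply path_deriv_const]. }
    cbv beta. ring. }
  assert (Dh : is_derive (fun s => Re (n * f (g s))) 0 (Cmod D ^ 2)).
  { replace (Cmod D ^ 2) with (Re (n * (l * Cconj D))).
    - apply Re_path_deriv_mult_const. apply path_deriv_comp; [now rewrite g0|exact Dg].
    - rewrite Cmult_assoc. fold D. now rewrite Cmod_sq_conj. }
  assert (PD2 : 0 < Cmod D ^ 2) by (apply pow_lt; exact PD).
  destruct (proj1 (is_derive_eps _ _ _) Dh (Cmod D ^ 2 / 2) ltac:(lra)) as [d [Hd K]].
  set (s := Rmin (d / 2) (eta / (2 * Cmod D))).
  assert (Hs : 0 < s) by (apply Rmin_glb_lt; [lra|apply Rdiv_lt_0_compat; lra]).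
  assert (Hs1 : s <= d / 2) by apply Rmin_l.
  assert (Hs2 : s <= eta / (2 * Cmod D)) by apply Rmin_r.
  exists (g s). split.
  - unfold g. replace (z0 + RtoC s * Cconj D - z0)%C with (RtoC s * Cconj D)%C by ring.
    rewrite Cmod_mult, Cmod_R, Cmod_conj, Rabs_pos_eq by lra.
    apply Rle_lt_trans with (eta / (2 * Cmod D) * Cmod D); [apply Rmult_le_compat_r; lra|].
    replace (eta / (2 * Cmod D) * Cmod D) with (eta / 2) by (field; lra). lra.
  - specialize (K s). rewrite Rminus_0_r, g0, (Rabs_pos_eq s) in K by lra.
    specialize (K ltac:(lra)). apply Rabs_le_between in K. nra.
Qed.

Lemma convex_univalent (f p dp : C -> C) :
  (forall z, unit_disk z -> has_cderiv f z (Cexp (p z))) ->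
  (forall z, unit_disk z -> has_cderiv p z (dp z)) ->
  (forall z, unit_disk z -> 0 < Re (1 + z * dp z)) ->
  univalent_on_disk f.
Proof.
  intros Hf Hp Hpos.
  assert (Main : forall z1 z2, unit_disk z2 -> Cmod z1 <= Cmod z2 -> z1 <> z2 -> f z1 <> f z2).
  { intros z1 z2 Hz2 Hle Hne Heq. unfold unit_disk in Hz2. pose proof PI2_pos as HPI.
    assert (Nz2 : z2 <> 0).
    { intro E. apply Hne. rewrite E in *. rewrite Cmod_0 in Hle. apply Cmod_eq_0.
      pose proof (Cmod_ge_0 z1). lra. }
    pose proof (proj1 (Cmod_gt_0 z2) Nz2) as Pz2.
    set (n := Cconj (z2 * Cexp (p z2))).
    assert (Nn : n <> 0).
    { apply Cmod_gt_0. unfold n. rewrite Cmod_conj. apply Cmod_gt_0.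
      apply Cmult_neq_0; [exact Nz2|apply Cexp_neq_0]. }
    set (u := fun z => Re (n * f z)).
    assert (Polar : forall z, Cmod z <= Cmod z2 -> exists rho t, 0 <= rho <= 1 /\ 0 <= t <= 2 * PI /\
      Cmod z = rho * Cmod z2 /\ z = (RtoC rho * (z2 * cis t))%C).
    { intros z Hz. destruct (polar_form (z / z2)) as [t [Ht Et]].
      exists (Cmod (z / z2)), t. rewrite Cmod_div in * by exact Nz2.
      split; [|split; [exact Ht|split]].
      - pose proof (Cmod_ge_0 z). split; [now apply Rdiv_le_0_compat|].
        apply Rmult_le_reg_r with (Cmod z2); [exact Pz2|].
        unfold Rdiv. rewrite Rmult_assoc, Rinv_l by lra. lra.
      - field. lra.
      - transitivity (z / z2 * z2)%C; [field; exact Nz2|]. rewrite Et at 1. ring. }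
    (* Polar coordinates based at z2 turn the closed disk |z| <= |z2| into a rectangle, where a
       maximum is available; the boundary circle becomes rho = 1, in the form required by
       [convex_circle_supporting_line]. *)
    set (U := fun rho t => u (RtoC rho * (z2 * cis t))%C).
    assert (Disk : forall rho t, 0 <= rho <= 1 -> Cmod (RtoC rho * (z2 * cis t)) = rho * Cmod z2).
    { intros rho t Hr. rewrite !Cmod_mult, Cmod_cis, Cmod_R, Rabs_pos_eq by lra. ring. }
    destruct (continuity_2d_attains_max U 0 1 0 (2 * PI)) as [rho0 [t0 [Hr0 [Ht0 Hmax]]]]; try lra.
    { intros rho t Hr _.
      assert (K : cont2 (fun rho t => n * f (RtoC rho * (z2 * cis t)))%C rho t).
      { apply cont2_mult; [apply cont2_snd, path_cont_const|].
        eapply cont2_comp.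
        - apply Hf. unfold unit_disk. rewrite Disk by lra. nra.
        - apply cont2_mult; [apply cont2_fst; eapply path_deriv_cont, path_deriv_RtoC|].
          apply cont2_snd. apply path_cont_mult; [apply path_cont_const|apply path_cont_cis]. }
      apply K. }
    set (z0 := (RtoC rho0 * (z2 * cis t0))%C) in *.
    assert (Max : forall z, Cmod z <= Cmod z2 -> u z <= u z0).
    { intros z Hz. destruct (Polar z Hz) as [rho [t [Hr [Ht [_ ->]]]]]. now apply Hmax. }
    assert (Inter : forall z, Cmod z < Cmod z2 -> u z < u z0).
    { intros z Hz. apply Rnot_le_lt. intro L.
      destruct (Re_no_interior_max f n z (Cexp (p z)) (Cmod z2 - Cmod z)) as [y [Hy1 Hy2]].
      - apply Hf. unfold unit_disk. lra.
      - exact Nn.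
      - apply Cexp_neq_0.
      - lra.
      - assert (Hy : Cmod y < Cmod z2) by (now apply near_in_ball with z).
        pose proof (Max y ltac:(lra)). unfold u in *. lra. }
    assert (Circ : forall z, Cmod z = Cmod z2 -> z <> z2 -> u z < u z2).
    { intros z Hz Nz. destruct (Polar z ltac:(lra)) as [rho [t [Hr [Ht [E1 E2]]]]].
      assert (rho = 1) by (apply Rmult_eq_reg_r with (Cmod z2); lra). subst rho.
      rewrite Cmult_1_l in E2.
      assert (Ht' : 0 < t < 2 * PI).
      { split; apply Rnot_le_lt; intro L; apply Nz; rewrite E2.
        - replace t with 0 by lra. rewrite cis_0. ring.
        - replace t with (2 * PI) by lra. rewrite cis_2PI. ring. }
      rewrite E2. now apply (convex_circle_supporting_line f p dp). }
    (* A maximiser cannot be interior, and every other point of the circle has a value below u z2;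
       so the maximum is u z2, and f z1 = f z2 would make z1 a second maximiser. *)
    assert (Hz0 : Cmod z0 = Cmod z2).
    { pose proof (Disk rho0 t0 Hr0) as K. fold z0 in K.
      destruct (Req_dec (Cmod z0) (Cmod z2)) as [E|E]; [exact E|].
      exfalso. assert (Cmod z0 < Cmod z2) by nra. pose proof (Inter z0 H). lra. }
    assert (Uz2 : u z0 = u z2).
    { destruct (Classical_Prop.classic (z0 = z2)) as [->|N]; [reflexivity|].
      pose proof (Circ z0 Hz0 N). pose proof (Max z2 ltac:(lra)). lra. }
    assert (U12 : u z1 = u z2) by (unfold u; now rewrite Heq).
    destruct (Rle_lt_or_eq_dec _ _ Hle) as [L|E].
    - pose proof (Inter z1 L). lra.
    - pose proof (Circ z1 E Hne). lra. }
  intros z1 z2 H1 H2 E. destruct (Classical_Prop.classic (z1 = z2)) as [K|K]; [exact K|exfalso].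
  destruct (Rle_dec (Cmod z1) (Cmod z2)) as [L|L].
  - now apply (Main z1 z2).
  - apply (Main z2 z1); auto. lra.
Qed.

(** With q z = (phi (i z) - 1) / z, p a primitive of q and f' the exponential of p, f' has no zero
    and f'' / f' = q. The required relation then holds by construction, and positivity of Re phi is
    exactly the convexity condition of [convex_univalent]. Integrating from 0 gives the
    normalisation f 0 = 0 and f' 0 = 1. *)
Lemma class_K_rotation_exists (phi : C -> C) :
  analytic_on_disk phi -> (forall z, unit_disk z -> 0 < Re (phi z)) -> phi 0 = 1 ->
  exists f, class_S f /\
    forall z, unit_disk z -> (1 + z * C_derive (C_derive f) z / C_derive f z)%C = phi (Ci * z)%C.
Proof.
  intros Hphi Hpos Hphi0.
  assert (Hrot : forall z, unit_disk z -> unit_disk (Ci * z)%C).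
  { intros z Hz. unfold unit_disk in *. now rewrite Cmod_mult, Cmod_Ci, Rmult_1_l. }
  assert (Hi : analytic_on_disk (fun z => Ci * z)%C).
  { apply (analytic_of_has_cderiv _ (fun _ => Ci)). intros z _. eapply has_cderiv_eq.
    2:{ apply has_cderiv_mult; [apply has_cderiv_const|apply has_cderiv_id]. }
    cbv beta. ring. }
  pose proof (analytic_comp phi (fun z => Ci * z)%C Hphi Hi Hrot) as HPhi.
  destruct (analytic_divided_difference_0 _ HPhi) as [q [Hq Eq]].
  cbv beta in Eq. rewrite Cmult_0_r, Hphi0 in Eq.
  set (p := SInt q 0). pose proof (analytic_has_primitive q Hq) as Dp. fold p in Dp.
  set (E := fun z => Cexp (p z)).
  assert (DE : forall z, unit_disk z -> has_cderiv E z (E z * q z)).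
  { intros z Hz. unfold E. apply has_cderiv_comp; [apply has_cderiv_Cexp|now apply Dp]. }
  assert (HE : analytic_on_disk E) by (eapply analytic_of_has_cderiv; exact DE).
  set (f := SInt E 0). pose proof (analytic_has_primitive E HE) as Df. fold f in Df.
  assert (S0 : forall g, SInt g 0 0 = 0) by (intro g; unfold SInt; ring).
  assert (D1 : forall z, unit_disk z -> C_derive f z = E z).
  { intros z Hz. now apply has_cderiv_unique, Df. }
  assert (D2 : forall z, unit_disk z -> C_derive (C_derive f) z = (E z * q z)%C).
  { intros z Hz. apply has_cderiv_unique. unfold unit_disk in Hz.
    apply (has_cderiv_ext_loc E _ _ _ (1 - Cmod z)); [lra| |now apply DE].
    intros y Hy. symmetry. apply D1. now apply near_in_ball with z. }
  exists f. split; [split; [split; [|split]|]|].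
  - eapply analytic_of_has_cderiv; exact Df.
  - unfold taylor_coeff. simpl. unfold f. rewrite S0. field.
  - unfold taylor_coeff. simpl. rewrite D1 by exact unit_disk_0.
    unfold E, p. rewrite S0, Cexp_0. field.
  - apply (convex_univalent f p q); auto.
    intros z Hz. rewrite (Eq z Hz). replace (1 + (phi (Ci * z) - 1))%C with (phi (Ci * z)%C) by ring.
    auto.
  - intros z Hz. rewrite D1, D2 by exact Hz.
    transitivity (1 + z * q z)%C; [field; apply Cexp_neq_0|]. rewrite (Eq z Hz). ring.
Qed.

Theorem theorem2p2 (phi : C -> C) (B1 B2 : R)
    (phi_analytic : analytic_on_disk phi)
    (phi_univalent : univalent_on_disk phi)
    (phi_pos : forall z : C, unit_disk z -> 0 < Re (phi z))
    (phi_0 : phi (RtoC 0) = RtoC 1)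
    (phi'_0_pos : Im (C_derive phi (RtoC 0)) = 0 /\ 0 < Re (C_derive phi (RtoC 0)))
    (phi''_0_real : Im (C_derive (C_derive phi) (RtoC 0)) = 0)
    (phi_B1 : taylor_coeff phi 1 = RtoC B1)
    (phi_B2 : taylor_coeff phi 2 = RtoC B2)
    (B1_pos : 0 < B1)
    (B1_le : B1 <= Rabs (B2 + B1 ^ 2)) :
  (forall f : C -> C, class_K phi f ->
     Cmod (toeplitz_det f 2 2) <= 1 / 36 * (B1 ^ 2 + B2) ^ 2 + 1 / 4 * B1 ^ 2) /\
  (exists f : C -> C, class_K phi f /\
     Cmod (toeplitz_det f 2 2) = 1 / 36 * (B1 ^ 2 + B2) ^ 2 + 1 / 4 * B1 ^ 2).
Proof.
  split.
  - intros f Hf. apply (toeplitz_det_bound phi); auto.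
  - destruct (class_K_rotation_exists phi phi_analytic phi_pos phi_0) as [f [Hf Ef]].
    set (w := fun z => (Ci * z)%C).
    assert (Dw : forall z, has_cderiv w z Ci).
    { intros z. eapply has_cderiv_eq.
      2:{ apply has_cderiv_mult; [apply has_cderiv_const|apply has_cderiv_id]. }
      cbv beta. ring. }
    assert (Hw : analytic_on_disk w) by (apply (analytic_of_has_cderiv _ (fun _ => Ci)); auto).
    assert (Hb : forall z, unit_disk z -> unit_disk (w z)).
    { intros z Hz. unfold unit_disk, w in *. now rewrite Cmod_mult, Cmod_Ci, Rmult_1_l. }
    assert (Hw0 : w 0 = 0) by (unfold w; ring).
    exists f. split; [split; [exact Hf|now exists w]|].
    assert (W1 : forall z, C_derive w z = Ci) by (intro z; now apply has_cderiv_unique).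
    assert (W2 : C_derive (C_derive w) 0 = 0).
    { apply has_cderiv_unique. apply (has_cderiv_ext (fun _ => Ci)); [now intro; rewrite W1|].
      apply has_cderiv_const. }
    destruct (subordinate_coefficients phi f w B1 B2) as [E2 E3]; auto; [apply Hf|].
    rewrite W1 in E2. rewrite W1, W2, Ci_sq in E3.
    rewrite toeplitz_det_2_2.
    set (a2 := taylor_coeff f 2) in *. set (a3 := taylor_coeff f 3) in *.
    (* Here a2 = i B1 / 2 and a3 = - (B2 + B1^2) / 6, so a2^2 is negative, a3^2 is nonnegative, and
       the determinant is minus the bound. *)
    replace (a2 * a2 - a3 * a3)%C with (RtoC (- (1 / 36 * (B1 ^ 2 + B2) ^ 2 + 1 / 4 * B1 ^ 2))).
    + rewrite Cmod_R, Rabs_Ropp, Rabs_pos_eq; [reflexivity|].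
      pose proof (pow2_ge_0 (B1 ^ 2 + B2)). pose proof (pow2_ge_0 B1). lra.
    + replace a2 with (RtoC (B1 / 2) * Ci)%C.
      2:{ transitivity (2 * a2 / 2)%C; [rewrite E2, RtoC_div by lra; field|field]. }
      replace a3 with (RtoC (- (B2 + B1 ^ 2) / 6)).
      2:{ transitivity (6 * a3 / 6)%C; [|field]. rewrite E3, RtoC_div, RtoC_opp by lra. field. }
      apply C_ext; unfold Re, Im; simpl; field.
Qed.
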